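(* Let $H$ be a fixed tree, let $c>0$ be a constant, and let $m(n)$ be integers with $cn\le m(n)\le (1+o(1))n$ as $n\to\infty$. Then \[ \mathbf{P}[P_{n,m}\text{ has a component isomorphic to } H]\to 1 \quad\text{as } n\to\infty. \]
   Context: $\mathcal{P}(n,m)$ denotes the set of all (simple, labelled) planar graphs on the vertex set $\{1,2,\ldots,n\}$ with exactly $m$ edges, and $P_{n,m}$ denotes a graph chosen uniformly at random from $\mathcal{P}(n,m)$. *)

(* Defs.v *)
From HB Require Import structures.
From mathcomp Require Import all_boot all_order all_algebra.
From mathcomp Require Import all_classical all_reals all_analysis.
Import Order.TTheory GRing.Theory Num.Theory.
Import numFieldNormedType.Exports.

Set Implicit Arguments.
Unset Strict Implicit.
Unset Printing Implicit Defensive.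

Local Open Scope ring_scope.

(* Finite simple graphs on the vertex set T: an edge is a 2-element subset. *)
Record sgraph (T : finType) := SGraph {
  edges : {set {set T}};
  edges_card2 : [forall e in edges, #|e| == 2%N] }.

HB.instance Definition _ (T : finType) := [isSub for @edges T].
HB.instance Definition _ (T : finType) := [Finite of sgraph T by <:].

Definition adj (T : finType) (G : sgraph T) : rel T :=
  fun x y => [set x; y]%SET \in edges G.

Definition isomorphic (T U : finType) (G : sgraph T) (H : sgraph U) : Prop :=
  exists2 f : T -> U, bijective f & forall x y, adj H (f x) (f y) = adj G x y.

Section Induced.
Variables (T : finType) (G : sgraph T) (C : {set T}).

Definition induced_edges : {set {set {x : T | x \in C}}} :=
  [set e : {set {x : T | x \in C}} | (val @: e)%SET \in edges G]%SET.

Lemma induced_edges_card2 : [forall e in induced_edges, #|e| == 2%N].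
Proof.
apply/forall_inP => e; rewrite inE => eG.
by have /forall_inP/(_ _ eG) := edges_card2 G; rewrite card_imset //; exact: val_inj.
Qed.

Definition induced_sgraph : sgraph {x : T | x \in C} := SGraph induced_edges_card2.

End Induced.

Definition component (T : finType) (G : sgraph T) (x : T) : {set T} :=
  [set y | connect (adj G) x y]%SET.

Definition has_component_iso (T U : finType) (G : sgraph T) (H : sgraph U) : Prop :=
  exists x : T, isomorphic (induced_sgraph G (component G x)) H.

(* Connected graphs are nonempty here, so the smallest tree is a single vertex. *)
Definition connected_graph (T : finType) (G : sgraph T) : Prop :=
  (0 < #|T|)%N /\ forall x y, connect (adj G) x y.

Definition acyclic (T : finType) (G : sgraph T) : Prop :=
  forall p : seq T, (2 < size p)%N -> ~ ucycle (adj G) p.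

Definition is_tree (T : finType) (G : sgraph T) : Prop :=
  connected_graph G /\ acyclic G.

(* G can be drawn in the plane R^2 without crossings: vertices are distinct
   points, the edge e is the simple arc arc e : [0, 1] -> R^2 joining its two
   ends, and the interior of an arc meets no vertex and no other arc. The
   values of arc outside edges G and of arc e outside [0, 1] are irrelevant. *)
Definition planar (R : realType) (T : finType) (G : sgraph T) : Prop :=
  exists (pos : T -> R * R) (arc : {set T} -> R -> R * R),
    [/\ injective pos,
        forall e, e \in edges G ->
          [/\ {within `[0, 1], continuous (arc e)}%classic,
              {in `[0, 1] &, injective (arc e)} &
              exists x y, [/\ e = [set x; y]%SET, arc e 0 = pos x & arc e 1 = pos y]],
        forall e t x, e \in edges G -> t \in `]0, 1[ -> arc e t <> pos x &
        forall e f s t, e \in edges G -> f \in edges G -> e != f ->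
          s \in `]0, 1[ -> t \in `]0, 1[ -> arc e s <> arc f t].

(* The vertex set {1, ..., n} is rendered as 'I_n = {0, ..., n - 1}. *)
Definition planar_graphs (R : realType) (n m : nat) : {set sgraph 'I_n} :=
  [set G : sgraph 'I_n | (#|edges G| == m) && `[< planar R G >]]%SET.

(* Probability that a uniformly random element of S satisfies A; it is 0 when
   S is empty, since x / 0 = 0. *)
Definition finite_uniform_prob (R : realType) (T : finType) (S : {set T}) (A : T -> Prop) : R :=
  #|[set x in S | `[< A x >]]%SET|%:R / #|S|%:R.

(* Main.v *)
(* Suppose that G has no component isomorphic to H. Vertices of degree at most 2 are
   plentiful; isolate h = |H| of them one by one, each time joining the two former neighbours
   (or keeping their edge), and put a copy of H on the freed vertices. There are of order n^h
   ways to do this, and the result comes from O(n^i) graphs if i of the h vertices were not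
   isolated in G. The number of edges has changed by e(H) - l with l >= i. If it increased, or
   stayed the same, the trivial bound a(k+1) = O(n a(k)) on the number a(k) of planar graphs
   with k edges still leaves a factor n, as e(H) < h. Otherwise the gain is a(k) = o(a(k+1))
   for k <= (1+o(1))n: a planar graph with that many edges has more than any constant times n
   edges whose addition keeps it planar.

   For the latter claim neither faces nor Euler's formula are needed. Deleting leaves and
   suppressing vertices of degree 2 (but never both ends of a subdivided edge) reduces the graph
   to one with o(n) non-isolated vertices or linearly many isolated ones; two vertices with the
   same image under the reduction, or with distinct isolated images, can be joined, because
   all that has to be redrawn lies near one vertex or in a disc crossed by one arc. *)

Require Import Defs.
From mathcomp Require Import all_boot all_order all_algebra.
From mathcomp Require Import all_classical all_reals all_analysis.
From mathcomp Require Import perm zify ring lra.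
Import Order.TTheory GRing.Theory Num.Theory.
Import numFieldNormedType.Exports.

Set Implicit Arguments.
Unset Strict Implicit.
Unset Printing Implicit Defensive.

Local Open Scope classical_set_scope.
Local Open Scope ring_scope.


(** * Arcs in the plane *)

Section arcs.
Variable R : realType.
Implicit Types (P Q S Z : R * R) (I J : set (R * R)).

(** Suppression, rather than deletion, is what balances the switching. A deleted vertex of degree 2
    could be put back in of order n^2 ways, whereas keeping its two neighbours as an edge leaves
    only O(n) preimages: one linear factor lost against the linear choice of the vertex. Every such
    factor is paid for by at least one lost edge.

    No o(.) is used before the final limit. A natural number t replaces it: if m <= (1 + 1/(10 s)) n
    with s = 4 t + 5 and n is large, then a(k) t <= a(k+1) for all k < m, and the proportion of
    graphs without a component H is at most K / t, where K depends only on |H| and on a bound D for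
    n / m. As K does not involve t, t can be chosen after the tolerance.

    The copies of H are tracked as well. Isolating a vertex creates at most two new ones, so the
    planted copy is one of at most 2h + 1 components of the result, and it can be located up to a
    bounded number of choices. *)

Definition open_arc P Q I := exists g : R -> R * R,
  [/\ continuous g, {in `[0, 1] &, injective g}, g 0 = P, g 1 = Q &
      I = [set g t | t in [set t | 0 < t < 1]]].

(** Truncation of [t] to [0, 1]; written with absolute values, it is visibly continuous. *)
Definition clamp (t : R) : R := (`|t| - `|t - 1| + 1) / 2.

Lemma clamp_itv t : 0 <= clamp t <= 1.
Proof.
rewrite /clamp; case: (lerP 0 t) => ht; case: (lerP 1 t) => h1;
 (rewrite ?(ger0_norm ht) ?(ltr0_norm ht));
 (have [h|h] := lerP 0 (t - 1); rewrite ?(ger0_norm h) ?(ltr0_norm h)); lra.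
Qed.

Lemma clamp_id t : 0 <= t <= 1 -> clamp t = t.
Proof. by move=> /andP[h0 h1]; rewrite /clamp ger0_norm// ler0_norm; lra. Qed.

Lemma clamp_le0 t : t <= 0 -> clamp t = 0.
Proof. by move=> h; rewrite /clamp ler0_norm// ler0_norm; lra. Qed.

Lemma clamp_ge1 t : 1 <= t -> clamp t = 1.
Proof. by move=> h; rewrite /clamp ger0_norm ?ger0_norm; lra. Qed.

Lemma clamp_continuous : continuous clamp.
Proof.
move=> t; apply: cvgMl; apply: cvgD; last exact: cvg_cst.
apply: cvgB; first exact: norm_continuous.
apply: cvg_norm; apply: cvgB; [exact: cvg_id|exact: cvg_cst].
Qed.

Lemma affine_continuous (a b : R) : continuous (fun t : R => a + b * t).
Proof. move=> t; apply: cvgD; [exact: cvg_cst|apply: cvgMr; exact: cvg_id]. Qed.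

(** Composing with [clamp] extends a path on [0, 1] to the whole line, so that arcs can be handled
    without subspace topologies. *)
Lemma arc_of_within (g : R -> R * R) :
  {within `[0, 1], continuous g} -> {in `[0, 1] &, injective g} ->
  open_arc (g 0) (g 1) [set g t | t in [set t | 0 < t < 1]].
Proof.
move=> gc gi; exists (g \o clamp); split => /=.
- move=> t; have /subspace_continuousP gc' := gc.
  have h x : `[0%R, 1%R]%classic (clamp x) by rewrite /= in_itv /= clamp_itv.
  apply: (cvg_comp clamp g) (gc' _ (h t)) => A /=.
  move=> /clamp_continuous hA.
  apply: (@filterS _ (nbhs t) _ (clamp @^-1` [set y | `[0, 1]%classic y -> A y])) hA => x /=.
  by apply; exact: h.
- move=> s t hs ht /=.
  by rewrite !clamp_id; [exact: gi| rewrite in_itv in ht | rewrite in_itv in hs].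
- by rewrite clamp_id ?lexx ?ler01.
- by rewrite clamp_id ?lexx ?ler01.
- by apply/seteqP; split => z [t ht <-]; exists t => //=;
    rewrite clamp_id//; case/andP: ht => a b; rewrite !ltW.
Qed.

Lemma arc_sym P Q I : open_arc P Q I -> open_arc Q P I.
Proof.
move=> [g [gc gi g0 g1 ->]]; exists (fun t => g (1 + (-1) * t)); split.
- move=> t; exact: (continuous_comp (@affine_continuous 1 (-1) t) (gc _)).
- move=> s t; rewrite !in_itv /= => hs ht /gi; rewrite !in_itv /= => h.
  have : 1 + -1 * s = 1 + -1 * t by apply: h; lra.
  lra.
- by rewrite mulr0 addr0.
- by rewrite mulr1 subrr.
- apply/seteqP; split => z [t /= ht <-]; exists (1 - t) => /=;
    [lra|congr g; lra|lra|congr g; lra].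
Qed.

Lemma arc_neq P Q I : open_arc P Q I -> P <> Q.
Proof.
move=> [g [_ gi g0 g1 _]] PQ; have : (0 : R) = 1.
  by apply: gi; rewrite ?in_itv /= ?lexx ?ler01 // g0 g1.
by move/eqP; rewrite eq_sym oner_eq0.
Qed.

Lemma arc_ends P Q I : open_arc P Q I -> ~ I P /\ ~ I Q.
Proof.
move=> [g [_ gi <- <- ->]]; split => -[t /= /andP[t0 t1]] /gi;
  rewrite !in_itv /= lexx ler01 !ltW // => /(_ isT isT) tE;
  by rewrite tE ltxx in t0 t1.
Qed.

(* Adding the two clamped halves avoids pasting continuous functions. *)
Lemma arc_cat P Q S I J : open_arc P Q I -> open_arc Q S J ->
  P <> S -> ~ J P -> ~ I S -> (forall z, I z -> ~ J z) ->
  open_arc P S (I `|` [set Q] `|` J).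
Proof.
move=> aI aJ PS JP IS IJ.
have [_ IQ] := arc_ends aI; have [JQ _] := arc_ends aJ.
have PQ := arc_neq aI; have QS := arc_neq aJ.
case: aI => [g [gc gi g0 g1 gI]]; case: aJ => [f [fc fi f0 f1 fJ]].
pose k (t : R) : R * R := g (clamp (0 + 2 * t)) + f (clamp (-1 + 2 * t)) - Q.
have kl t : 0 <= t <= 1/2 -> k t = g (2 * t).
  move=> ht; rewrite /k (@clamp_le0 (-1 + _)); last by lra.
  by rewrite clamp_id ?add0r ?f0 ?addrK //; lra.
have kr t : 1/2 <= t <= 1 -> k t = f (-1 + 2 * t).
  move=> ht; rewrite /k (@clamp_ge1 (0 + _)); last by lra.
  by rewrite clamp_id ?g1 1?addrC ?addKr //; lra.
have Ig t : 0 < t < 1/2 -> I (k t).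
  by move=> ht; rewrite kl; [rewrite gI; exists (2 * t) => //=; lra|lra].
have kh : k (1/2) = Q by rewrite kl; [rewrite -g1; congr g; lra|lra].
have Jf t : 1/2 < t < 1 -> J (k t).
  by move=> ht; rewrite kr; [rewrite fJ; exists (-1 + 2 * t) => //=; lra|lra].
have k0 : k 0 = P by rewrite kl; [rewrite mulr0|lra].
have k1 : k 1 = S by rewrite kr; [rewrite -f1; congr f; lra|lra].
have kinj s t : 0 <= s -> s < t -> t <= 1 -> k s <> k t.
  move=> s0 st t1 kst.
  have [t2|t2] := leP t (1/2).
    have : 2 * s = 2 * t by apply: gi; rewrite ?in_itv /=; [lra|lra|rewrite -!kl //; lra].
    lra.
  have [s2|s2] := leP (1/2) s.
    have : -1 + 2 * s = -1 + 2 * t.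
      by apply: fi; rewrite ?in_itv /=; [lra|lra|rewrite -!kr //; lra].
    lra.
  have [tE|t1'] := eqVneq t 1.
    rewrite tE k1 in kst; have [sE|s0'] := eqVneq s 0.
      by apply: PS; rewrite -k0 -sE.
    by apply: IS; rewrite -kst; apply: Ig; rewrite lt_neqAle eq_sym s0' s0.
  have Jt : J (k t) by apply: Jf; rewrite t2 lt_neqAle t1' t1.
  have [sE|s0'] := eqVneq s 0.
    by apply: JP; rewrite -k0 -sE kst.
  by apply: (IJ (k s)); [apply: Ig; rewrite s2 lt_neqAle eq_sym s0' s0|rewrite kst].
exists k; split => //.
- move=> t; apply: cvgB; last exact: cvg_cst.
  have cl (a b : R) : continuous (fun t : R => clamp (a + b * t)).
    by move=> u; exact: (continuous_comp (@affine_continuous a b u) (@clamp_continuous _)).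
  apply: cvgD; [exact: (continuous_comp (@cl 0 2 t) (gc _))|
                exact: (continuous_comp (@cl (-1) 2 t) (fc _))].
- move=> s t; rewrite !in_itv /= => /andP[s0 s1] /andP[t0 t1] kst.
  by have [st|ts|//] := ltgtP s t; [case: (kinj s t)|case: (kinj t s)].
- apply/seteqP; split => z.
    move=> [[Iz|->]|Jz].
    + move: Iz; rewrite gI => -[t /= ht <-]; exists (t / 2) => /=; first lra.
      by rewrite kl; [congr g; lra|lra].
    + by exists (1/2) => //=; lra.
    + move: Jz; rewrite fJ => -[t /= ht <-]; exists ((1 + t) / 2) => /=; first lra.
      by rewrite kr; [congr f; lra|lra].
  move=> [t /= /andP[t0 t1] <-].
  have [h|h|->] := ltgtP t (1/2).
  + by left; left; apply: Ig; rewrite t0 h.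
  + by right; apply: Jf; rewrite t1 h.
  + by left; right.
Qed.

Lemma arc_sub (g : R -> R * R) (a b : R) : continuous g ->
  {in `[0, 1] &, injective g} -> 0 <= a -> a < b -> b <= 1 ->
  open_arc (g a) (g b) [set g t | t in [set t | a < t < b]].
Proof.
move=> gc gi a0 ab b1; exists (fun t => g (a + (b - a) * t)).
have ba : 0 < b - a by lra.
split.
- move=> t; exact: (continuous_comp (@affine_continuous a (b - a) t) (gc _)).
- move=> s t; rewrite !in_itv /= => hs ht h.
  have : a + (b - a) * s = a + (b - a) * t.
    by apply: gi => //; rewrite in_itv /=; apply/andP; split; nra.
  by move/addrI/mulfI; apply; rewrite gt_eqF.
- by rewrite mulr0 addr0.
- by rewrite mulr1 subrKC.
- apply/seteqP; split => z [t /= ht <-].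
    exists ((t - a) / (b - a)) => /=.
      by rewrite divr_gt0 ?ltr_pdivrMr //; lra.
    by congr g; field; rewrite gt_eqF.
  by exists (a + (b - a) * t) => //=; apply/andP; split; nra.
Qed.

Lemma arc_split P Q I : open_arc P Q I -> exists M J K,
  [/\ open_arc P M J, open_arc M Q K, I = J `|` [set M] `|` K & forall z, J z -> ~ K z].
Proof.
move=> [g [gc gi <- <- ->]].
exists (g (1/2)), [set g t | t in [set t | 0 < t < 1/2]],
  [set g t | t in [set t | 1/2 < t < 1]]; split.
- by apply: arc_sub => //; lra.
- by apply: arc_sub => //; lra.
- apply/seteqP; split => z.
    move=> [t /= ht <-]; have [h|h|->] := ltgtP t (1/2).
    + by left; left; exists t => //=; lra.
    + by right; exists t => //=; lra.
    + by left; right.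
  by move=> [[[t /= ht <-]|->]|[t /= ht <-]]; [exists t|exists (1/2)|exists t] => //=; lra.
- move=> z [t /= ht <-] [s /= hs /gi]; rewrite !in_itv /= => h.
  by have : s = t by [apply: h; lra]; lra.
Qed.

End arcs.

Ltac pair_ring := apply/pair_eqP; rewrite /= /GRing.scale /=; apply/andP; split; apply/eqP; ring.

(** * Segments, spheres and small discs in the maximum norm *)

Section metric_arcs.
Variable R : realType.
Implicit Types (P Q S Z : R * R) (I J : set (R * R)).

Definition segment P Q : set (R * R) :=
  [set P + t *: (Q - P) | t in [set t | 0 < t < 1]].

Lemma arc_segment P Q : P <> Q -> open_arc P Q (segment P Q).
Proof.
move=> PQ; exists (fun t : R => P + t *: (Q - P)); split => //.
- move=> t; apply: cvgD; [exact: cvg_cst|apply: cvgZl; exact: cvg_id].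
- move=> s t _ _ /addrI/eqP; rewrite -subr_eq0 -scalerBl scaler_eq0 !subr_eq0.
  by case/orP => /eqP // h; case: PQ.
- by rewrite scale0r addr0.
- by rewrite scale1r addrC subrK.
Qed.

Lemma dist_continuous (g : R -> R * R) Z :
  continuous g -> continuous (fun t => `|g t - Z|).
Proof.
by move=> gc t; apply: cvg_norm; apply: cvgB; [exact: gc|exact: cvg_cst].
Qed.

(** The distance to [Z] attains a positive minimum on the compact arc; half of it gives the strict
    bound. *)
Lemma arc_avoid P Q I Z : open_arc P Q I -> ~ I Z -> Z <> P -> Z <> Q ->
  exists2 r, 0 < r & forall z, I z -> r < `|z - Z|.
Proof.
move=> [g [gc gi g0 g1 ->]] IZ ZP ZQ.
have [|c cI hc] := @EVT_min _ (fun t => `|g t - Z|) 0 1 ler01.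
  exact/continuous_subspaceT/dist_continuous.
have hpos : 0 < `|g c - Z|.
  rewrite normr_gt0 subr_eq0; apply/eqP => gZ.
  move: cI; rewrite in_itv /= => /andP[c0 c1].
  have [cE|c0'] := eqVneq c 0; first by apply: ZP; rewrite -gZ cE.
  have [cE|c1'] := eqVneq c 1; first by apply: ZQ; rewrite -gZ cE.
  by apply: IZ; exists c => //=; rewrite !lt_neqAle eq_sym c0' c0 c1' c1.
exists (`|g c - Z| / 2); first by rewrite divr_gt0.
move=> z [t /= /andP[t0 t1] <-]; apply: lt_le_trans (hc t _).
  by rewrite ltr_pdivrMr // ltr_pMr // ltr1n.
by rewrite in_itv /= !ltW.
Qed.

Lemma arc_bounded P Q I : open_arc P Q I -> exists B, forall z, I z -> `|z| <= B.
Proof.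
move=> [g [gc gi g0 g1 ->]].
have [|c cI hc] := @EVT_max _ (fun t => `|g t - 0|) 0 1 ler01.
  exact/continuous_subspaceT/dist_continuous.
exists `|g c - 0| => z [t /= /andP[t0 t1] <-].
by rewrite -[g t]subr0; apply: hc; rewrite in_itv /= !ltW.
Qed.

(* [S] is the last point of the arc on the sphere of radius [r] about [P]. *)
Lemma arc_exit P Q I r : open_arc P Q I -> 0 < r -> r < `|Q - P| ->
  exists S J, [/\ I S, `|S - P| = r, open_arc S Q J, (forall z, J z -> I z) &
                  forall z, J z -> r < `|z - P|].
Proof.
move=> [g [gc gi g0 g1 ->]] r0 rQ.
pose d t := `|g t - P|; have dc : continuous d by exact: dist_continuous.
have dcw a b : {within `[a, b], continuous d}.
  exact: continuous_subspaceT.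
pose A := [set t : R | 0 <= t <= 1 /\ d t <= r].
have A0 : A 0 by rewrite /A /= lexx ler01 /d g0 subrr normr0 ltW.
have supA : has_sup A.
  by split; [exists 0|exists 1 => t [/andP[]]].
pose c := sup A.
have c0 : 0 <= c by apply: ub_le_sup => //; case: supA.
have c1 : c <= 1 by apply: ge_sup => [|t [/andP[]] //]; case: supA.
have dgt t : c < t -> t <= 1 -> r < d t.
  move=> ct t1; rewrite ltNge; apply/negP => dt; have : t <= c.
    apply: ub_le_sup; first by case: supA.
    by split => //; rewrite t1 (le_trans c0 (ltW ct)).
  by rewrite leNgt ct.
have dcle : d c <= r.
  rewrite leNgt; apply/negP => rc.
  have /nbhs_ballP[e /= e0 he] : \forall t \near c, r < d t.
    exact: (@cvgr_gt _ _ (nbhs c) _ d (d c) (dc c) r rc).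
  have [t At ct] := sup_adherent e0 supA.
  have : r < d t.
    apply: he; rewrite /ball /= ltr_norml; have := ub_le_sup (proj2 supA) At; rewrite -/c => ?.
    by rewrite -/c in ct; lra.
  by rewrite ltNge (proj2 At).
have d1 : r < d 1 by rewrite /d g1.
have clt : c < 1.
  by rewrite lt_neqAle c1 andbT; apply: contraTneq d1 => <-; rewrite -leNgt.
have dcE : d c = r.
  have [|t] := @IVT _ d c 1 r c1 (dcw _ _).
    by rewrite ge_min dcle /= le_max (ltW d1) orbT.
  rewrite in_itv /= => /andP[ct t1] dt.
  have [<- //|tc] := eqVneq t c.
  by have := dgt t; rewrite dt ltxx lt_neqAle eq_sym tc ct t1 => /(_ isT isT).
have c0' : 0 < c.
  rewrite lt_neqAle c0 andbT; apply/eqP => cE.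
  by move: dcE; rewrite -cE /d g0 subrr normr0 => rE; rewrite rE ltxx in r0.
exists (g c), [set g t | t in [set t | c < t < 1]]; split => //.
- by exists c => //=; rewrite c0' clt.
- by rewrite -g1; apply: arc_sub.
- by move=> z [t /= /andP[ct t1] <-]; exists t => //=; rewrite t1 (lt_trans c0' ct).
- by move=> z [t /= /andP[ct t1] <-]; apply: dgt => //; exact: ltW.
Qed.

Lemma prod_norm (z : R * R) : `|z| = Num.max `|z.1| `|z.2|.
Proof. by rewrite prod_normE. Qed.

Lemma segment_in_ball P Q Z r z : `|P - Z| <= r -> `|Q - Z| <= r ->
  segment P Q z -> `|z - Z| <= r.
Proof.
move=> Pr Qr [t /= /andP[t0 t1] <-].
have -> : P + t *: (Q - P) - Z = (1 - t) *: (P - Z) + t *: (Q - Z).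
  by pair_ring.
apply: le_trans (ler_normD _ _) _; rewrite !normrZ (gtr0_norm t0) gtr0_norm ?subr_gt0 //.
have -> : r = (1 - t) * r + t * r by ring.
by apply: lerD; rewrite ler_pM2l ?subr_gt0.
Qed.

Lemma radius_segment P S z : P <> S -> segment P S z -> `|z - P| < `|S - P|.
Proof.
move=> PS [t /= /andP[t0 t1] <-]; rewrite addrAC subrr add0r normrZ gtr0_norm //.
by rewrite gtr_pMl // normr_gt0; apply/eqP => /subr0_eq SP; apply: PS.
Qed.

Lemma segment_sym P Q z : segment P Q z -> segment Q P z.
Proof.
move=> [t /= /andP[t0 t1] <-]; exists (1 - t) => /=; first lra.
by pair_ring.
Qed.

Lemma radii_disjoint P S S' z : P <> S -> `|S - P| = `|S' - P| ->
  segment P S z -> segment P S' z -> S = S'.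
Proof.
move=> PS SS' [t /= /andP[t0 t1] <-] [s /= /andP[s0 s1] /addrI h].
have S0 : 0 < `|S - P| by rewrite normr_gt0 subr_eq0; apply/eqP => SP; apply: PS.
have : `|s *: (S' - P)| = `|t *: (S - P)| by rewrite h.
rewrite !normrZ !gtr0_norm // -SS' => /mulIf; rewrite gt_eqF // => /(_ isT) st.
rewrite st in h; move/scalerI : h; rewrite gt_eqF // => /(_ isT).
by move/addIr.
Qed.

(** Twice the signed area of the triangle; it is nonzero exactly when the three points are not
    collinear. *)
Definition det3 P Q S : R :=
  (Q.1 - P.1) * (S.2 - P.2) - (Q.2 - P.2) * (S.1 - P.1).

Lemma det3C P Q S : det3 P Q S != 0 -> det3 P S Q != 0.
Proof. by apply: contraNneq => h; rewrite -oppr_eq0 -h /det3; apply/eqP; ring. Qed.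

Lemma det3R P Q S : det3 P Q S != 0 -> det3 Q S P != 0.
Proof. by apply: contraNneq => <-; rewrite /det3; apply/eqP; ring. Qed.

Lemma det3_neq P Q S : det3 P Q S != 0 -> P <> Q.
Proof. by move/eqP => h PQ; apply: h; rewrite /det3 PQ; ring. Qed.

Lemma sides_disjoint P Q S z : det3 P Q S != 0 ->
  segment P Q z -> ~ segment P S z.
Proof.
move=> d0 [t /= /andP[t0 t1] <-] [s /= _ /addrI [h1 h2]].
have : t * det3 P Q S = 0.
  have h1' : s * (S.1 - P.1) = t * (Q.1 - P.1) by exact: h1.
  have h2' : s * (S.2 - P.2) = t * (Q.2 - P.2) by exact: h2.
  transitivity (t * (Q.1 - P.1) * (S.2 - P.2) - t * (Q.2 - P.2) * (S.1 - P.1)).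
    by rewrite /det3; ring.
  by rewrite -h1' -h2'; ring.
by apply/eqP; rewrite mulf_neq0 // gt_eqF.
Qed.

Lemma apex_notin_side P Q S : det3 P Q S != 0 -> ~ segment P Q S.
Proof.
move=> + [t _ h]; rewrite -h => /eqP; apply.
by rewrite /det3 /= /GRing.scale /=; ring.
Qed.

(** No line contains [Z] together with its two shifts by [r] along the axes, so one of these three
    points will do. *)
Lemma exists_apex P Q Z r : P <> Q -> 0 < r ->
  exists2 S, `|S - Z| <= r & det3 P Q S != 0.
Proof.
move=> PQ r0.
have [h|h] := eqVneq (det3 P Q Z) 0; last by exists Z; rewrite // subrr normr0 ltW.
have [h1|h1] := eqVneq (det3 P Q (Z.1 + r, Z.2)) 0; last first.
  exists (Z.1 + r, Z.2) => //; rewrite prod_norm /= addrAC !subrr add0r normr0.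
  by rewrite gtr0_norm // ge_max lexx ltW.
have [h2|h2] := eqVneq (det3 P Q (Z.1, Z.2 + r)) 0; last first.
  exists (Z.1, Z.2 + r) => //; rewrite prod_norm /= addrAC !subrr add0r normr0.
  by rewrite gtr0_norm // ge_max lexx ltW.
case: PQ; move: h h1 h2; rewrite /det3 /= => h h1 h2.
have e1 : r * (Q.2 - P.2) = 0 by lra.
have e2 : r * (Q.1 - P.1) = 0 by lra.
move/eqP: e1; move/eqP: e2; rewrite !mulf_eq0 !(gt_eqF r0) /= !subr_eq0 => /eqP a /eqP b.
by rewrite [P]surjective_pairing [Q]surjective_pairing a b.
Qed.

(** For each point of [D] in turn, the search continues in the half of the interval that the point
    does not enter. *)
Lemma gap_avoiding (D : seq R) (l u : R) : l < u ->
  exists y1 y2, [/\ l < y1, y1 < y2, y2 < u & forall d, d \in D -> ~~ (y1 <= d <= y2)].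
Proof.
elim: D l u => [|d D IH] l u lu.
  by exists (l + (u - l) / 3), (l + 2 * (u - l) / 3); split => //; lra.
have [dm|dm] := leP d ((l + u) / 2).
  have [|y1 [y2 [h1 h2 h3 h4]]] := IH ((l + u) / 2) u; first lra.
  exists y1, y2; split => //; first lra.
  move=> d'; rewrite inE => /predU1P[->|]; last exact: h4.
  by rewrite negb_and -!ltNge (le_lt_trans dm h1).
have [|y1 [y2 [h1 h2 h3 h4]]] := IH l ((l + u) / 2); first lra.
exists y1, y2; split => //; first lra.
move=> d'; rewrite inE => /predU1P[->|]; last exact: h4.
by rewrite negb_and -!ltNge (lt_trans h3 dm) orbT.
Qed.

(** Spheres of the maximum norm are squares, and the points (r, y) with |y| < r form the right side
    of this one. A gap between the heights of the points of [D] gives two such points, and [A], [B]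
    lie halfway to them. A point of the triangle at height ratio y that was also on the radius to
    [d] would, by comparing norms, force [d] to have height y, inside the gap. *)
Lemma free_sector (D : seq (R * R)) Z r : 0 < r ->
  (forall d, d \in D -> `|d - Z| = r) ->
  exists A B, det3 Z A B != 0 /\ forall z,
    (segment Z A `|` [set A] `|` segment A B `|` [set B] `|` segment Z B) z ->
    [/\ `|z - Z| < r, z <> Z & forall d, d \in D -> ~ segment Z d z].
Proof.
move=> r0 Dr; have [|y1 [y2 [l1 l12 l2 yD]]] := @gap_avoiding [seq d.2 - Z.2 | d <- D] (- r) r.
  by lra.
exists (Z.1 + r / 2, Z.2 + y1 / 2), (Z.1 + r / 2, Z.2 + y2 / 2); split.
  rewrite /det3 /= (_ : _ - _ = r * (y2 - y1) / 4); last by field.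
  by rewrite gt_eqF // !mulr_gt0 ?subr_gt0 ?invr_gt0.
move=> z hz.
have [l [y [l0 le1 /andP[yl yu] zE]]] : exists l y,
    [/\ 0 < l, l <= 1, y1 <= y <= y2 & z = (Z.1 + l * (r / 2), Z.2 + l * (y / 2))].
  case: hz => [[[[|->]|]|->]|].
  - move=> [t /= /andP[t0 t1] <-]; exists t, y1.
    by split; [lra|lra|apply/andP; split; lra|pair_ring].
  - exists 1, y1; by split; [lra|lra|apply/andP; split; lra|pair_ring].
  - move=> [t /= /andP[t0 t1] <-]; exists 1, (y1 + t * (y2 - y1)).
    by split; [lra|lra|apply/andP; split; nra|pair_ring].
  - exists 1, y2; by split; [lra|lra|apply/andP; split; lra|pair_ring].
  - move=> [t /= /andP[t0 t1] <-]; exists t, y2.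
    by split; [lra|lra|apply/andP; split; lra|pair_ring].
have yr : `|y| < r by rewrite ltr_norml; apply/andP; split; lra.
have nz : `|z - Z| = l * (r / 2).
  rewrite zE prod_norm /= ![_ + _ - _]addrAC !subrr !add0r !normrM !(gtr0_norm l0).
  rewrite gtr0_norm ?divr_gt0 // normfV (@gtr0_norm _ 2) //.
  by apply/max_idPl; rewrite ler_pM2l // ler_pM2r ?invr_gt0 // ltW.
split.
- by rewrite nz; nra.
- by move=> zZ; move: nz; rewrite zZ subrr normr0; nra.
- move=> d dD [t /= /andP[t0 t1] tz]; have dr := Dr _ dD.
  have : `|z - Z| = t * r by rewrite -tz addrAC subrr add0r normrZ gtr0_norm // dr.
  rewrite nz => lt2; have lE : l = 2 * t by apply: (mulIf (lt0r_neq0 r0)); lra.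
  have /yD : d.2 - Z.2 \in [seq d.2 - Z.2 | d <- D] by apply: map_f.
  have : t * (d.2 - Z.2) = t * y.
    have := congr1 snd tz; rewrite zE /= => h.
    have -> : t * y = l * (y / 2) by rewrite lE; field.
    by apply: (addrI Z.2); exact: h.
  by move/mulfI; rewrite gt_eqF // => /(_ isT) ->; rewrite yl yu.
Qed.

End metric_arcs.

(** * Planar drawings *)

Section drawings.
Variables (R : realType) (T : finType).
Implicit Types (pos : T -> R * R) (X : set (R * R)) (E F : {set {set T}}) (e f : {set T}).
Implicit Types (a b v w x y : T) (Z : R * R).

Lemma set2_eq a b x y : [set a; b]%SET = [set x; y]%SET -> a != b ->
  (x = a /\ y = b) \/ (x = b /\ y = a).
Proof.
move=> h ab.
have : x \in [set a; b]%SET by rewrite h !inE eqxx.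
have : y \in [set a; b]%SET by rewrite h !inE eqxx orbT.
have : a \in [set x; y]%SET by rewrite -h !inE eqxx.
have : b \in [set x; y]%SET by rewrite -h !inE eqxx orbT.
rewrite !inE => /orP[] /eqP hb /orP[] /eqP ha; subst; rewrite ?eqxx // in ab *; by auto.
Qed.

(** The formula of [planar] for a bare edge set: edges can be added and removed without carrying a
    proof that they have two ends. That they do is a consequence, by injectivity of the arcs. *)
Definition planarE E : Prop :=
  exists (pos : T -> R * R) (arc : {set T} -> R -> R * R),
    [/\ injective pos,
        forall e, e \in E ->
          [/\ {within `[0, 1], continuous (arc e)}%classic,
              {in `[0, 1] &, injective (arc e)} &
              exists x y, [/\ e = [set x; y]%SET, arc e 0 = pos x & arc e 1 = pos y]],
        forall e t x, e \in E -> t \in `]0, 1[ -> arc e t <> pos x &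
        forall e f s t, e \in E -> f \in E -> e != f ->
          s \in `]0, 1[ -> t \in `]0, 1[ -> arc e s <> arc f t].

(* [X] is any superset of the drawing, so that erasing an arc or moving a vertex is a set
   operation on [X]. *)
Definition drawn pos E X := exists I : {set T} -> set (R * R),
  [/\ injective pos,
      forall e, e \in E -> exists x y,
        e = [set x; y]%SET /\ open_arc (pos x) (pos y) (I e),
      forall e x, e \in E -> ~ I e (pos x),
      forall e f z, e \in E -> f \in E -> e != f -> I e z -> ~ I f z &
      (forall x, X (pos x)) /\ forall e z, e \in E -> I e z -> X z].

Lemma planarE_drawn E : planarE E <-> exists pos, drawn pos E setT.
Proof.
split.
  move=> [pos [g [pi gE gp gd]]]; exists pos.
  exists (fun e => [set g e t | t in [set t | 0 < t < 1]]); split => //.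
  - move=> e /gE[gc gi [x [y [eE g0 g1]]]]; exists x, y; split => //.
    by rewrite -g0 -g1; exact: arc_of_within.
  - by move=> e x eE [t /= ht]; apply: gp => //; rewrite in_itv.
  - move=> e f z eE fE ef [t /= ht <-] [s /= hs /esym]; apply: gd => //;
    by rewrite in_itv.
move=> [pos [I [pi IE Ip Id _]]].
have h e : exists g : R -> R * R, e \in E ->
   exists x y, e = [set x; y]%SET /\ [/\ continuous g, {in `[0, 1] &, injective g},
     g 0 = pos x, g 1 = pos y & I e = [set g t | t in [set t | 0 < t < 1]]].
  case: (boolP (e \in E)) => [/IE[x [y [exy [g hg]]]]|]; last by exists (fun=> 0).
  by exists g => _; exists x, y.
case: (choice h) => g hg; exists pos, g; split => //.
- move=> e /hg[x [y [exy [gc gi g0 g1 _]]]]; split => //; last by exists x, y.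
  exact: continuous_subspaceT.
- move=> e t x eE; have [_ [_ [_ [_ _ _ _ hI]]]] := hg _ eE; rewrite in_itv => ht ex.
  by apply: (Ip _ x eE); rewrite hI; exists t.
- move=> e f s t eE fE ef; rewrite !in_itv => hs ht efs.
  have [_ [_ [_ [_ _ _ _ hI]]]] := hg _ eE; have [_ [_ [_ [_ _ _ _ hJ]]]] := hg _ fE.
  by apply: (Id e f (g e s)) => //; [rewrite hI; exists s|rewrite hJ; exists t].
Qed.

Lemma drawn_sub pos E F X Y : drawn pos E X -> F \subset E -> X `<=` Y -> drawn pos F Y.
Proof.
move=> [I [pi IE Ip Id [Xp XI]]] /fintype.subsetP FE XY; exists I; split => //.
- by move=> e /FE /IE.
- by move=> e x /FE; exact: Ip.
- by move=> e f z /FE eE /FE; exact: Id.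
- by split => [x|e z /FE eE Iz]; apply: XY; [exact: Xp|exact: XI Iz].
Qed.

Lemma planarE_sub E F : planarE E -> F \subset E -> planarE F.
Proof.
by rewrite !planarE_drawn => -[pos h] FE; exists pos; apply: drawn_sub h FE _.
Qed.

Lemma planarE_simple E e : planarE E -> e \in E -> exists x y, x != y /\ e = [set x; y]%SET.
Proof.
rewrite planarE_drawn => -[pos [I [pi IE _ _ _]]] /IE[x [y [exy /arc_neq hxy]]].
by exists x, y; split => //; apply/eqP => xy; apply: hxy; rewrite xy.
Qed.

Lemma planarE_card2 E e : planarE E -> e \in E -> #|e| = 2%N.
Proof. by move=> pE /(planarE_simple pE)[x [y [xy ->]]]; rewrite cards2 xy. Qed.

Lemma planarE_neq E a b : planarE E -> [set a; b]%SET \in E -> a != b.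
Proof.
move=> pE abE; have := planarE_card2 pE abE; rewrite cards2.
by case: (a != b).
Qed.

Lemma drawn_inj pos E X : drawn pos E X -> injective pos.
Proof. by case=> I []. Qed.

Lemma drawn_pos pos E X x : drawn pos E X -> X (pos x).
Proof. by case=> I [_ _ _ _ []]. Qed.

Lemma drawn_del pos E X a b : drawn pos E X -> [set a; b]%SET \in E ->
  exists J, [/\ open_arc (pos a) (pos b) J, J `<=` X, forall x, ~ J (pos x) &
    drawn pos (E :\ [set a; b]%SET) (X `\` J)].
Proof.
move=> [I [pi IE Ip Id [Xp XI]]] abE; exists (I [set a; b]%SET); split.
- have [x [y [exy h]]] := IE _ abE.
  have xy : x != y by apply/eqP => xy; case: (arc_neq h); rewrite xy.
  by move: h; case: (set2_eq (esym exy) xy) => -[<- <-] //; exact: arc_sym.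
- by move=> z; exact: XI.
- by move=> x; exact: Ip.
- exists I; split => //.
  + by move=> e /setD1P[_ /IE].
  + by move=> e x /setD1P[_]; exact: Ip.
  + by move=> e f z /setD1P[_ eE] /setD1P[_ fE]; exact: Id.
  + split => [x|e z /setD1P[ne eE] Iz]; first by split; [exact: Xp|exact: Ip].
    by split; [exact: XI Iz|exact: Id Iz].
Qed.

Lemma drawn_add pos E X a b J : drawn pos E X -> open_arc (pos a) (pos b) J ->
  (forall z, J z -> ~ X z) -> drawn pos ([set a; b]%SET |: E) (X `|` J).
Proof.
move=> dE aJ JX.
case: (boolP ([set a; b]%SET \in E)) => abE.
  by apply: (drawn_sub dE); [rewrite finset.subUset finset.sub1set abE subxx|move=> z; left].
move: dE => [I [pi IE Ip Id [Xp XI]]].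
pose I' e := if e == [set a; b]%SET then J else I e.
have I'E e : e \in E -> I' e = I e.
  by move=> eE; rewrite /I' ifN //; apply: contraNneq abE => <-.
have I'ab : I' [set a; b]%SET = J by rewrite /I' eqxx.
exists I'; split => //.
- move=> e /setU1P[->|eE]; last by rewrite I'E //; exact: IE.
  by rewrite I'ab; exists a, b.
- move=> e x /setU1P[->|eE]; last by rewrite I'E //; exact: Ip.
  by rewrite I'ab => /JX; apply; exact: Xp.
- move=> e f z /setU1P[->|eE] /setU1P[->|fE] ef; rewrite ?eqxx // ?I'ab ?I'E // in ef *.
  + by move=> /JX Xz /(XI _ _ fE).
  + by move=> Iz /JX; apply; exact: XI Iz.
  + exact: Id.
- split => [x|e z /setU1P[->|eE]]; first by left; exact: Xp.
    by rewrite I'ab; right.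
  by rewrite I'E // => Iz; left; exact: XI Iz.
Qed.

Definition isolated E v := [forall e in E, v \notin e].

Lemma isolatedP E v : reflect (forall e, e \in E -> v \notin e) (isolated E v).
Proof. exact: forall_inP. Qed.

Definition upd pos v Z : T -> R * R := fun x => if x == v then Z else pos x.

Lemma updE pos v Z : upd pos v Z v = Z.
Proof. by rewrite /upd eqxx. Qed.

Lemma updN pos v Z x : x != v -> upd pos v Z x = pos x.
Proof. by move=> /negPf h; rewrite /upd h. Qed.

Lemma drawn_move pos E X v Z : drawn pos E X -> isolated E v -> ~ X Z ->
  drawn (upd pos v Z) E ((X `\` [set pos v]) `|` [set Z]).
Proof.
move=> [I [pi IE Ip Id [Xp XI]]] /isolatedP vE XZ; exists I; split => //.
- move=> x y; rewrite /upd; case: (eqVneq x v) => xv; case: (eqVneq y v) => yv.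
  + by rewrite xv yv.
  + by move=> h; case: XZ; rewrite h; exact: Xp.
  + by move=> h; case: XZ; rewrite -h; exact: Xp.
  + exact: pi.
- move=> e eE; have [x [y [exy h]]] := IE _ eE; exists x, y; split => //.
  have := vE _ eE; rewrite {1}exy !inE negb_or ![v == _]eq_sym => /andP[xv yv].
  by rewrite (updN _ _ xv) (updN _ _ yv).
- move=> e x eE; rewrite /upd; case: (eqVneq x v) => xv; last exact: Ip.
  by move=> /(XI _ _ eE).
- split => [x|e z eE Iz].
    rewrite /upd; case: (eqVneq x v) => xv; first by right.
    by left; split; [exact: Xp|move=> /= /pi /eqP; apply/negP].
  by left; split; [exact: XI Iz|move=> /= zE; apply: (Ip _ v eE); rewrite -zE].
Qed.

Lemma finite_radius (A : finType) (P : A -> R -> Prop) :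
  (forall a : A, exists2 r, 0 < r & P a r) ->
  (forall (a : A) (r s : R), P a r -> 0 < s -> s <= r -> P a s) ->
  exists2 r, 0 < r & forall a : A, P a r.
Proof.
move=> Pex Pmon.
suff [r r0 h] : exists2 r, 0 < r & forall a : A, a \in enum A -> P a r.
  by exists r => // a; apply: h; rewrite mem_enum.
elim: (enum A) => [|a s [r r0 IH]]; first by exists 1.
have [q q0 hq] := Pex a.
have m0 : 0 < Num.min q r by rewrite lt_min q0.
exists (Num.min q r) => // b; rewrite inE => /predU1P[->|/IH h].
  by apply: Pmon hq m0 _; rewrite ge_min lexx.
by apply: Pmon h m0 _; rewrite ge_min lexx orbT.
Qed.

Lemma drawn_avoid pos E X Z : drawn pos E X -> ~ X Z ->
  exists2 r, 0 < r & drawn pos E (X `&` [set z | r < `|z - Z|]).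
Proof.
move=> [I [pi IE Ip Id [Xp XI]]] XZ.
have [r r0 hr] : exists2 r, 0 < r & forall x, r < `|pos x - Z|.
  apply: finite_radius => [x|x r s h _ sr]; last exact: le_lt_trans sr h.
  exists (`|pos x - Z| / 2).
    by rewrite divr_gt0 // normr_gt0; apply/eqP => /subr0_eq h; apply: XZ; rewrite -h.
  rewrite ltr_pdivrMr // ltr_pMr ?ltr1n // normr_gt0.
  by apply/eqP => /subr0_eq h; apply: XZ; rewrite -h.
have [q q0 hq] : exists2 r, 0 < r & forall e, e \in E -> forall z, I e z -> r < `|z - Z|.
  apply: finite_radius => [e|e q s h _ sq]; last first.
    by move=> eE z Iz; apply: le_lt_trans sq (h eE z Iz).
  case: (boolP (e \in E)) => eE; last by exists 1.
  have [x [y [_ axy]]] := IE _ eE.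
  have [|||q q0 hq] := @arc_avoid _ _ _ _ Z axy.
  - by move=> /(XI _ _ eE).
  - by move=> h; apply: XZ; rewrite h.
  - by move=> h; apply: XZ; rewrite h.
  by exists q.
exists (Num.min r q); first by rewrite lt_min r0.
exists I; split => //; split => [x|e z eE Iz]; split => /=.
- exact: Xp.
- by rewrite gt_min hr.
- exact: XI Iz.
- by rewrite gt_min (hq _ eE _ Iz) orbT.
Qed.

Lemma finite_bound (A : finType) (P : A -> R -> Prop) :
  (forall a : A, exists r, P a r) -> (forall (a : A) (r s : R), P a r -> r <= s -> P a s) ->
  exists r, forall a : A, P a r.
Proof.
move=> Pex Pmon.
suff [r h] : exists r, forall a : A, a \in enum A -> P a r.
  by exists r => a; apply: h; rewrite mem_enum.
elim: (enum A) => [|a s [r IH]]; first by exists 1.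
have [q hq] := Pex a.
exists (Num.max q r) => b; rewrite inE => /predU1P[->|/IH h].
  by apply: Pmon hq _; rewrite le_max lexx.
by apply: Pmon h _; rewrite le_max lexx orbT.
Qed.

Lemma drawn_bounded pos E X : drawn pos E X ->
  exists B, drawn pos E (X `&` [set z | `|z| <= B]).
Proof.
move=> [I [pi IE Ip Id [Xp XI]]].
have [r hr] : exists r, forall x, `|pos x| <= r.
  apply: finite_bound => [x|x r s]; first by exists `|pos x|.
  exact: le_trans.
have [q hq] : exists r, forall e, e \in E -> forall z, I e z -> `|z| <= r.
  apply: finite_bound => [e|e q s h sq]; last first.
    by move=> eE z Iz; apply: le_trans (h eE z Iz) sq.
  case: (boolP (e \in E)) => eE; last by exists 1.
  have [x [y [_ axy]]] := IE _ eE.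
  by have [q hq] := arc_bounded axy; exists q.
exists (Num.max r q); exists I; split => //; split => [x|e z eE Iz]; split => /=.
- exact: Xp.
- by rewrite le_max hr.
- exact: XI Iz.
- by rewrite le_max (hq _ eE _ Iz) orbT.
Qed.

Lemma drawn_fresh pos E X : drawn pos E X -> exists Y Z, [/\ Y `<=` X, drawn pos E Y & ~ Y Z].
Proof.
move=> /drawn_bounded[B hB]; exists (X `&` [set z | `|z| <= B]), (`|B| + 1, 0).
split => //.
move=> [_ /=]; rewrite prod_norm /= normr0 => h.
have : `|B| + 1 <= B by apply: le_trans h; rewrite le_max ler_norm.
by have := ler_norm B; lra.
Qed.

End drawings.

(** * Planarity-preserving operations *)

(** Relabelling vertices and passing to a subgraph at once: the drawing of [E] is pulled back along
    [f]. *)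
Lemma planarE_map (R : realType) (S T : finType) (f : S -> T)
    (E : {set {set T}}) (F : {set {set S}}) :
  injective f -> (forall e, e \in F -> (f @: e)%SET \in E) ->
  planarE R E -> planarE R F.
Proof.
move=> fi FE /planarE_drawn[pos [I [pi IE Ip Id _]]]; apply/planarE_drawn.
exists (pos \o f), (fun e : {set S} => I (f @: e)%SET); split => //=.
- exact: inj_comp.
- move=> e /FE eE; have [x [y [exy h]]] := IE _ eE.
  have : x \in (f @: e)%SET by rewrite exy !inE eqxx.
  have : y \in (f @: e)%SET by rewrite exy !inE eqxx orbT.
  move=> /imsetP[y' y'e yE] /imsetP[x' x'e xE].
  exists x', y'; split; last by rewrite /= -xE -yE.
  by apply: (imset_inj fi); rewrite exy finset.imsetU !finset.imset_set1 xE yE.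
- by move=> e x /FE; exact: Ip.
- move=> e g z /FE eE /FE gE eg; apply: Id => //.
  by apply/eqP => h; move/eqP: eg; apply; exact: (imset_inj fi) h.
Qed.

(** Provides a spare isolated vertex [None], placed at a point off the drawing. *)
Lemma planarE_option (R : realType) (T : finType) (E : {set {set T}}) :
  planarE R E -> planarE R [set (Some @: e)%SET | e : {set T} in E]%SET.
Proof.
move=> /planarE_drawn[pos /drawn_fresh[X [Z [_ [I [pi IE Ip Id [Xp XI]]] XZ]]]].
apply/planarE_drawn.
pose pos' x := if x is Some y then pos y else Z.
exists pos', (fun e : {set option T} => I (Some @^-1: e)%SET).
have K (e : {set T}) : (Some @^-1: (Some @: e))%SET = e.
  by apply/setP => x; rewrite inE mem_imset //; exact: Some_inj.
split => //.
- move=> [x|] [y|] //=; first by move=> /pi ->.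
    by move=> h; case: XZ; rewrite -h.
  by move=> h; case: XZ; rewrite h.
- move=> _ /imsetP[e eE ->]; rewrite K; have [x [y [exy h]]] := IE _ eE.
  by exists (Some x), (Some y); split => //; rewrite exy imsetU !imset_set1.
- move=> _ [x|] /imsetP[e eE ->] /=; rewrite K; first exact: Ip.
  by move=> /(XI _ _ eE).
- move=> _ _ z /imsetP[e eE ->] /imsetP[f fE ->] ef; rewrite !K.
  by apply: Id => //; apply: contraNneq ef => ->.
Qed.

Section operations.
Variables (R : realType) (T : finType).
Implicit Types (pos : T -> R * R) (X : set (R * R)) (E F : {set {set T}}) (e f : {set T}).
Implicit Types (a b v w x y : T) (Z : R * R).

(** A sufficiently small disc about [w] is met only by the arcs of the edges at [w]. Each of these
    is cut at its last point on the bounding sphere, and everything before that point is replaced by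
    a radius. The arcs being disjoint, their cut points differ, so the radii do not meet; near [w]
    the drawing is then a star. *)
Lemma drawn_straighten pos E X w : drawn pos E X ->
  exists (r : R) (D : seq (R * R)) Y,
  [/\ 0 < r, drawn pos E Y, forall d, d \in D -> `|d - pos w| = r &
      forall z, Y z -> `|z - pos w| < r ->
        z = pos w \/ exists2 d, d \in D & segment (pos w) d z].
Proof.
move=> [I [pi IE Ip Id [Xp XI]]].
have [r1 r10 hr1] : exists2 r, 0 < r & forall x, x != w -> r < `|pos x - pos w|.
  apply: finite_radius => [x|x r s h _ sr xw]; last by apply: le_lt_trans sr (h xw).
  have [->|xw] := eqVneq x w; first by exists 1.
  have d0 : 0 < `|pos x - pos w|.
    by rewrite normr_gt0; apply/eqP => /subr0_eq /pi /eqP; apply/negP.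
  by exists (`|pos x - pos w| / 2) => [|_]; lra.
have [r2 r20 hr2] : exists2 r, 0 < r & forall e, e \in E -> w \notin e ->
    forall z, I e z -> r < `|z - pos w|.
  apply: finite_radius => [e|e q s h _ sq]; last first.
    by move=> eE we z Iz; apply: le_lt_trans sq (h eE we z Iz).
  case: (boolP (e \in E)) => eE; last by exists 1.
  case: (boolP (w \in e)) => we; first by exists 1.
  have [x [y [exy axy]]] := IE _ eE.
  have [wx wy] : w <> x /\ w <> y.
    by split => h; move: we; rewrite exy !inE h eqxx ?orbT.
  have [|||q q0 hq] := @arc_avoid _ _ _ _ (pos w) axy; last by exists q.
  - exact: Ip.
  - by move=> /pi.
  - by move=> /pi.
pose r := Num.min r1 r2.
have r0 : 0 < r by rewrite lt_min r10.
have far x : x != w -> r < `|pos x - pos w|.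
  by move=> /hr1; apply: le_lt_trans; rewrite ge_min lexx.
have farI e z : e \in E -> w \notin e -> I e z -> r < `|z - pos w|.
  by move=> eE we Iz; apply: le_lt_trans (hr2 _ eE we _ Iz); rewrite ge_min lexx orbT.
have ex e : exists SJ : (R * R) * set (R * R), e \in E -> w \in e ->
    exists y, [/\ e = [set w; y]%SET, y != w, `|SJ.1 - pos w| = r, I e SJ.1 &
    [/\ open_arc SJ.1 (pos y) SJ.2, SJ.2 `<=` I e & forall z, SJ.2 z -> r < `|z - pos w|]].
  case: (boolP (e \in E)) => eE; last by exists (0, set0).
  case: (boolP (w \in e)) => we; last by exists (0, set0).
  have [x [y [exy axy]]] := IE _ eE.
  have xy : x != y by apply/eqP => xy; case: (arc_neq axy); rewrite xy.
  have [u [eu uw au]] : exists u, [/\ e = [set w; u]%SET, u != w & open_arc (pos w) (pos u) (I e)].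
    move: we; rewrite {1}exy !inE => /orP[] /eqP wE.
      by exists y; rewrite {1}exy wE eq_sym xy.
    by exists x; rewrite {1}exy {1}finset.setUC wE xy; split => //; exact: arc_sym.
  have [S [J [IS Sr aJ JI Jr]]] := arc_exit au r0 (far _ uw).
  by exists (S, J) => _ _; exists u.
case: (choice ex) => SJ hSJ {ex}.
pose I' e := if w \in e then segment (pos w) (SJ e).1 `|` [set (SJ e).1] `|` (SJ e).2
             else I e.
have wS e : e \in E -> w \in e -> pos w <> (SJ e).1.
  move=> eE we h; have [y [_ _ hr _ _]] := hSJ _ eE we.
  by move: hr r0; rewrite -h subrr normr0 => ->; rewrite ltxx.
have K e z : e \in E -> I' e z ->
    [/\ w \in e, segment (pos w) (SJ e).1 z & `|z - pos w| < r] \/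
    (I e z /\ r <= `|z - pos w|).
  move=> eE; rewrite /I'; case: ifPn => we; last first.
    by move=> Iz; right; split => //; exact/ltW/(farI _ _ eE we).
  have [y [_ _ hr IS [_ JI Jr]]] := hSJ _ eE we.
  move=> [[hz|->]|Jz].
  - by left; split => //; rewrite -hr; apply: radius_segment => //; exact: wS.
  - by right; split => //; rewrite hr.
  - by right; split; [exact: JI|exact/ltW/Jr].
pose Y := [set z | (exists x, z = pos x) \/ exists e, e \in E /\ I' e z].
exists r, [seq (SJ e).1 | e <- enum E & w \in e], Y; split => //.
- exists I'; split => //.
  + move=> e eE; rewrite /I'; case: ifPn => we; last exact: IE.
    have [y [ey yw hr IS [aJ JI Jr]]] := hSJ _ eE we; exists w, y; split => //.
    apply: arc_cat aJ _ _ _ _.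
    * exact/arc_segment/wS.
    * by move=> /pi /eqP; apply/negP; rewrite eq_sym.
    * by move=> /Jr; rewrite subrr normr0 ltNge ltW.
    * move=> /(radius_segment (wS _ eE we)); rewrite hr => h.
      by have := far _ yw; rewrite ltNge ltW.
    * move=> z /(radius_segment (wS _ eE we)); rewrite hr => h /Jr.
      by rewrite ltNge ltW.
  + move=> e x eE /(K _ _ eE) [[we hs hx]|[Iz _]]; last exact: Ip Iz.
    have [xw|xw] := eqVneq x w; last by have := far _ xw; rewrite ltNge ltW.
    by have [h _] := arc_ends (arc_segment (wS _ eE we)); apply: h; rewrite -{2}xw.
  + move=> e f z eE fE ef /(K _ _ eE) [[we hs hx]|[Iz hz]] /(K _ _ fE) [[wf hs' hx']|[Iz' hz']].
    * have [_ [_ _ hr IS _]] := hSJ _ eE we; have [_ [_ _ hr' IS' _]] := hSJ _ fE wf.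
      have h : (SJ e).1 = (SJ f).1.
        by apply: (radii_disjoint (wS _ eE we)) hs hs'; rewrite hr hr'.
      by apply: (Id _ _ _ eE fE ef IS); rewrite h.
    * by move: hx; rewrite ltNge hz'.
    * by move: hx'; rewrite ltNge hz.
    * exact: Id Iz Iz'.
  + by split => [x|e z eE Iz]; [left; exists x|right; exists e].
- move=> d /mapP[e]; rewrite mem_filter mem_enum => /andP[we eE] ->.
  by have [_ [_ _ hr _ _]] := hSJ _ eE we.
- move=> z [[x ->]|[e [eE /(K _ _ eE)]]] hz.
    have [->|xw] := eqVneq x w; first by left.
    by have := far _ xw; rewrite ltNge ltW.
  case: hz => [[we hs _] _|[_ hz]]; last by rewrite ltNge hz.
  by right; exists (SJ e).1 => //; apply: map_f; rewrite mem_filter we mem_enum.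
Qed.

Lemma drawn_sector pos E X w : drawn pos E X ->
  exists Y A B, [/\ drawn pos E Y, det3 (pos w) A B != 0 &
    forall z, (segment (pos w) A `|` [set A] `|` segment A B `|` [set B] `|`
               segment (pos w) B) z -> ~ Y z].
Proof.
move=> /(drawn_straighten w)[r [D [Y [r0 dY Dr hY]]]].
have [A [B [d0 h]]] := free_sector r0 Dr.
exists Y, A, B; split => // z /h[zr zw zD] /hY /(_ zr) [//|[d dD]].
exact: zD.
Qed.

(** The isolated vertex is moved to a corner of a small triangle at [w] whose sides avoid the
    drawing. *)
Lemma planarE_pendant E v w : planarE R E -> isolated E v -> v != w ->
  planarE R ([set v; w]%SET |: E).
Proof.
move=> /planarE_drawn[pos dE] vE vw; apply/planarE_drawn.
have [Y [A [B [dY d0 hY]]]] := drawn_sector w dE.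
exists (upd pos v A).
have dm := drawn_move dY vE (hY A (or_introl (or_introl (or_introl (or_intror erefl))))).
apply: drawn_sub (drawn_add (J := segment A (pos w)) dm _ _) _ _ => //.
- rewrite updE updN 1?eq_sym //; apply: arc_segment => h.
  by apply: (det3_neq d0).
- move=> z /segment_sym hz [[Yz _]|zA]; first by apply: hY Yz; left; left; left; left.
  have [_ h] := arc_ends (arc_segment (det3_neq d0)); apply: h.
  by rewrite -{2}zA.
Qed.

(** The two isolated vertices are moved to the two corners of the free triangle at [w]. Most of the
    proof checks that its three sides are disjoint from one another and from the moved vertices. *)
Lemma planarE_triangle E v x w : planarE R E -> isolated E v -> isolated E x ->
  v != w -> x != w -> v != x ->
  planarE R ([set v; w]%SET |: ([set w; x]%SET |: ([set v; x]%SET |: E))).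
Proof.
move=> /planarE_drawn[pos dE] vE xE vw xw vx; apply/planarE_drawn.
have [Y [A [B [dY d0 hY]]]] := drawn_sector w dE.
have hWA z : segment (pos w) A z -> ~ Y z by move=> hz; apply: hY; left; left; left; left.
have hA : ~ Y A by apply: hY; left; left; left; right.
have hAB z : segment A B z -> ~ Y z by move=> hz; apply: hY; left; left; right.
have hB : ~ Y B by apply: hY; left; right.
have hWB z : segment (pos w) B z -> ~ Y z by move=> hz; apply: hY; right.
have dm := drawn_move dY vE hA.
have dAB : A <> B by exact: det3_neq (det3R d0).
have dWA : pos w <> A by exact: det3_neq d0.
have dWB : pos w <> B by exact: det3_neq (det3C d0).
have hB' : ~ ((Y `\` [set pos v]) `|` [set A]) B by move=> [[]//|/esym].
have dm2 := drawn_move dm xE hB'.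
set pos' := upd _ _ _ in dm2; set X2 := (_ `|` _) in dm2.
have pw : pos' w = pos w by rewrite /pos' !updN // eq_sym.
have pv : pos' v = A by rewrite /pos' updN // updE.
have px : pos' x = B by rewrite /pos' updE.
have nX z : ~ Y z -> z <> A -> z <> B -> ~ X2 z.
  by move=> Yz zA zB [[[[]|]]|].
have seg_neq (P Q z : R * R) : P <> Q -> segment P Q z -> z <> P /\ z <> Q.
  move=> PQ hz; have [h1 h2] := arc_ends (arc_segment PQ).
  by split => zE; [apply: h1; rewrite -{2}zE|apply: h2; rewrite -{2}zE].
have s1 z : segment A B z -> ~ X2 z.
  by move=> hz; have [zA zB] := seg_neq _ _ _ dAB hz; apply: nX => //; exact: hAB.
have d1 := drawn_add (a := v) (b := x) dm2 (J := segment A B).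
rewrite pv px in d1; have {}d1 := d1 (arc_segment dAB) s1.
have s2 z : segment (pos w) B z -> ~ (X2 `|` segment A B) z.
  move=> hz [|]; last first.
    move=> /segment_sym hz'; apply: sides_disjoint hz' (segment_sym hz).
    exact: det3C (det3R (det3R d0)).
  have [zW zB] := seg_neq _ _ _ dWB hz; apply: nX => //; first exact: hWB.
  by move=> zA; apply: (apex_notin_side (det3C d0)); rewrite -zA.
have d2 := drawn_add (a := w) (b := x) d1 (J := segment (pos w) B).
rewrite pw px in d2; have {}d2 := d2 (arc_segment dWB) s2.
have s3 z : segment A (pos w) z -> ~ ((X2 `|` segment A B) `|` segment (pos w) B) z.
  move=> hz [[|]|].
  - have [zA zW] := seg_neq _ _ _ (nesym dWA) hz; apply: nX => //.
      exact/hWA/segment_sym.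
    by move=> zB; apply: (apex_notin_side d0); rewrite -zB; exact: segment_sym.
  - by move=> hz'; apply: sides_disjoint hz' hz; exact: det3R d0.
  - by move=> hz'; apply: sides_disjoint (segment_sym hz) hz'.
have d3 := drawn_add (a := v) (b := w) d2 (J := segment A (pos w)).
rewrite pv pw in d3; have {}d3 := d3 (arc_segment (nesym dWA)) s3.
by exists pos'; apply: drawn_sub d3 _ _.
Qed.

Lemma planarE_subdivide E a b v : planarE R E -> [set a; b]%SET \in E -> isolated E v ->
  planarE R ([set a; v]%SET |: ([set v; b]%SET |: (E :\ [set a; b]%SET))).
Proof.
move=> /planarE_drawn[pos dE] abE vE; apply/planarE_drawn.
have [J [aJ _ Jp dD]] := drawn_del dE abE.
have [M [J1 [J2 [a1 a2 JE J12]]]] := arc_split aJ.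
have [va vb] : v != a /\ v != b.
  by have /isolatedP/(_ _ abE) := vE; rewrite !inE negb_or => /andP.
have vE' : isolated (E :\ [set a; b]%SET) v.
  by apply/isolatedP => e /setD1P[_]; move/isolatedP: vE; exact.
have JM : J M by rewrite JE; left; right.
have dm := drawn_move dD vE' (fun h => proj2 h JM).
set X2 := (_ `|` _) in dm.
have nX z : J z -> z <> M -> ~ X2 z by move=> Jz zM [[[]]|].
have [_ M1] := arc_ends a1; have [M2 _] := arc_ends a2.
have s2 z : J2 z -> ~ X2 z.
  move=> Jz; apply: nX; first by rewrite JE; right.
  by move=> zM; apply: M2; rewrite -zM.
have d1 := drawn_add (a := v) (b := b) dm (J := J2).
rewrite updE updN 1?eq_sym // in d1; have {}d1 := d1 a2 s2.
have d2 := drawn_add (a := a) (b := v) d1 (J := J1).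
rewrite updE updN 1?eq_sym // in d2; have {}d2 := d2 a1.
exists (upd pos v M); apply: drawn_sub (d2 _) _ _ => //.
move=> z Jz [|]; last exact: J12.
apply: nX; first by rewrite JE; left; left.
by move=> zM; apply: M1; rewrite -zM.
Qed.

(** The two arcs at [v], together with the point of [v], form the arc of the new edge. *)
Lemma planarE_suppress E a b v : planarE R E -> a != b ->
  [set v; a]%SET \in E -> [set v; b]%SET \in E ->
  (forall e, e \in E -> v \in e -> e = [set v; a]%SET \/ e = [set v; b]%SET) ->
  planarE R ([set a; b]%SET |: (E :\ [set v; a]%SET :\ [set v; b]%SET)).
Proof.
move=> pE ab vaE vbE vE; have va := planarE_neq pE vaE; have vb := planarE_neq pE vbE.
move/planarE_drawn: pE => [pos dE]; apply/planarE_drawn.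
have [J [aJ _ Jp dD]] := drawn_del dE vaE.
have vbE' : [set v; b]%SET \in E :\ [set v; a]%SET.
  rewrite in_setD1 vbE andbT; apply/eqP => /set2_eq/(_ vb)[[_ h]|[h _]].
    by rewrite h eqxx in ab.
  by rewrite -h eqxx in vb.
have [K [aK KJ Kp dD2]] := drawn_del dD vbE'.
have vI : isolated (E :\ [set v; a]%SET :\ [set v; b]%SET) v.
  apply/isolatedP => e /setD1P[e1 /setD1P[e2 eE]]; apply/negP => ve.
  by case: (vE _ eE ve) => h; [move/eqP: e2|move/eqP: e1].
(* The new arc runs through the old place of [v], so [v] is sent farther out than both arcs and the
   rest of the drawing. *)
have [Z' [Y' [Y'X dY' Y'Z]]] : exists Z' Y', [/\ Y' `<=` ([set: R * R] `\` J) `\` K, drawn pos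
    (E :\ [set v; a]%SET :\ [set v; b]%SET) Y' &
    [/\ ~ Y' Z', ~ J Z', ~ K Z' & Z' <> pos v]].
  have [B1 hJ] := arc_bounded aJ; have [B2 hK] := arc_bounded aK.
  have [B3 dY'] := drawn_bounded dD2.
  pose B := Num.max `|B1| (Num.max `|B2| `|B3|).
  have nB z : `|z| = B + 1 -> [/\ ~ `|z| <= B1, ~ `|z| <= B2 & ~ `|z| <= B3].
    have m1 : B1 <= B by apply: le_trans (ler_norm _) _; rewrite le_max lexx.
    have m2 : B2 <= B by apply: le_trans (ler_norm _) _; rewrite !le_max lexx orbT.
    have m3 : B3 <= B by apply: le_trans (ler_norm _) _; rewrite !le_max lexx !orbT.
    by move=> ->; split => h; lra.
  have B0 : 0 <= B by rewrite le_max normr_ge0.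
  have [n1 n2 n3] : [/\ ~ `|(B + 1, 0 : R)| <= B1, ~ `|(B + 1, 0 : R)| <= B2 &
      ~ `|(B + 1, 0 : R)| <= B3].
    apply: nB; rewrite prod_norm /= normr0 ger0_norm; last by lra.
    by apply/max_idPl; lra.
  exists (B + 1, 0), ((([set: R * R] `\` J) `\` K) `&` [set z | `|z| <= B3]); split.
  - by move=> z [h _].
  - exact: dY'.
  - split; [by move=> [_ /n3]|by move=> /hJ|by move=> /hK|].
    by move=> h; have := drawn_pos v dY'; rewrite -h => -[].
case: Y'Z => Y'Z JZ KZ Zv.
have dm := drawn_move dY' vI Y'Z.
set X2 := (_ `|` _) in dm.
have nX z : J z \/ K z \/ z = pos v -> ~ X2 z.
  move=> hz [[/Y'X [[_ nJ] nK] zv]|zZ]; first by case: hz => [|[]].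
  by case: hz => [|[]]; rewrite zZ.
have d1 := drawn_add (a := a) (b := b) dm (J := J `|` [set pos v] `|` K).
rewrite !updN 1?eq_sym // in d1.
exists (upd pos v Z'); apply: drawn_sub (d1 _ _) _ _ => //.
  apply: arc_cat (arc_sym aJ) aK _ _ _ _ => //.
  - by move=> /(drawn_inj dE) /eqP; apply/negP.
  - by move=> z Jz Kz; case: (KJ _ Kz).
move=> z [[Jz|->]|Kz]; apply: nX; auto.
Qed.

End operations.

(** * Doubling an edge between two vertices of degree 2 *)

Section parallel.
Variables (R : realType) (T : finType).
Implicit Types (E : {set {set T}}) (a b p q x : T).

(** Drawing a curve alongside a given arc would need a tubular neighbourhood. Instead the edge is
    shrunk: [p] and [q] slide along it to points [S1], [S2] on a small sphere about an inner point
    [M], in a disc that the rest of the drawing avoids. Their only other edges, to [a] and [b], are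
    prolonged along the abandoned pieces [K1], [K2] of the arc. The edge and the path through [x]
    then become the sides of a triangle in the disc. *)
Lemma planarE_parallel E p q a b x : planarE R E ->
  [set p; q]%SET \in E -> [set p; a]%SET \in E -> [set q; b]%SET \in E ->
  a != q -> b != p -> isolated E x ->
  (forall e, e \in E -> p \in e -> e = [set p; q]%SET \/ e = [set p; a]%SET) ->
  (forall e, e \in E -> q \in e -> e = [set p; q]%SET \/ e = [set q; b]%SET) ->
  planarE R ([set p; x]%SET |: ([set x; q]%SET |: E)).
Proof.
move=> pE pqE paE qbE aq bp xE pI qI.
have pq := planarE_neq pE pqE; have pa := planarE_neq pE paE; have qb := planarE_neq pE qbE.
have xn y z : [set y; z]%SET \in E -> x != y /\ x != z.
  by move/isolatedP: xE => h /h; rewrite !inE negb_or => /andP.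
have [xp xq] := xn _ _ pqE; have [_ xa] := xn _ _ paE; have [_ xb] := xn _ _ qbE.
move/planarE_drawn: pE => [pos dE]; apply/planarE_drawn.
have [J [aJ _ Jp dD]] := drawn_del dE pqE.
have paE' : [set p; a]%SET \in E :\ [set p; q]%SET.
  rewrite in_setD1 paE andbT; apply/eqP => /set2_eq/(_ pa)[[_ h]|[h _]].
    by rewrite h eqxx in aq.
  by rewrite -h eqxx in pa.
have [Ja [aJa JaJ Jap dD1]] := drawn_del dD paE'.
have qbE' : [set q; b]%SET \in E :\ [set p; q]%SET :\ [set p; a]%SET.
  rewrite !in_setD1 qbE andbT; apply/andP; split; apply/eqP => /set2_eq/(_ qb)[[h h']|[h h']].
  - by rewrite h eqxx in pq.
  - by rewrite h eqxx in bp.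
  - by rewrite h eqxx in pq.
  - by rewrite h eqxx in bp.
have [Jb [aJb JbJ Jbp dD2]] := drawn_del dD1 qbE'.
set E0 := _ :\ [set q; b]%SET in dD2.
have sE0 : E0 \subset E by rewrite /E0 !(fintype.subset_trans (finset.subsetDl _ _)) ?subxx.
have [M [J1 [J2 [a1 a2 JE J12]]]] := arc_split aJ.
have JM : J M by rewrite JE; left; right.
have XM : ~ (([set: R * R] `\` J `\` Ja) `\` Jb) M by move=> [[[_ /(_ JM)]]].
have [r1 r10 dD3] := drawn_avoid dD2 XM.
have JaM : ~ Ja M by move=> /JaJ[].
have JbM : ~ Jb M by move=> /JbJ[[]].
have Mp y : M <> pos y by move=> h; apply: (Jp y); rewrite -h.
have [r2 r20 hr2] := arc_avoid aJa JaM (Mp _) (Mp _).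
have [r3 r30 hr3] := arc_avoid aJb JbM (Mp _) (Mp _).
pose r := Num.min r1 (Num.min r2 r3).
have r0 : 0 < r by rewrite !lt_min r10 r20.
have farA z : Ja z -> r < `|z - M|.
  by move=> /hr2; apply: le_lt_trans; rewrite /r !ge_min lexx !orbT.
have farB z : Jb z -> r < `|z - M|.
  by move=> /hr3; apply: le_lt_trans; rewrite /r !ge_min lexx !orbT.
set X := (_ `&` _) in dD3.
have farX z : X z -> r < `|z - M|.
  by move=> [_ /=]; apply: le_lt_trans; rewrite /r !ge_min lexx.
have farp y : r < `|pos y - M| by apply: farX; exact: drawn_pos dD3.
have XJ z : X z -> [/\ ~ J z, ~ Ja z & ~ Jb z] by move=> [[[[_ ?] ?] ?] _].
have [S1 [K1 [JS1 S1r aK1 KJ1 farK1]]] := arc_exit (arc_sym a1) r0 (farp _).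
have [S2 [K2 [JS2 S2r aK2 KJ2 farK2]]] := arc_exit a2 r0 (farp _).
have KJ1' z : K1 z -> J z by move=> /KJ1 Jz; rewrite JE; left; left.
have KJ2' z : K2 z -> J z by move=> /KJ2 Jz; rewrite JE; right.
have JS1' : J S1 by rewrite JE; left; left.
have JS2' : J S2 by rewrite JE; right.
have S12 : S1 <> S2 by move=> h; apply: (J12 S1) => //; rewrite h.
have [V Vr Vdet] := exists_apex M S12 r0.
have near y Z : `|Z - M| <= r -> Z <> pos y.
  by move=> h Zy; move: (farp y); rewrite -Zy ltNge h.
have S1le : `|S1 - M| <= r by rewrite S1r.
have S2le : `|S2 - M| <= r by rewrite S2r.
have S1V : S1 <> V by exact: det3_neq (det3C Vdet).
have S2V : S2 <> V by exact: det3_neq (det3R Vdet).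
have farN Z (Y : set (R * R)) : (forall z, Y z -> r < `|z - M|) -> `|Z - M| <= r -> ~ Y Z.
  by move=> hY h /hY; rewrite ltNge h.
have pI0 : isolated E0 p.
  apply/isolatedP => e /setD1P[e1 /setD1P[e2 /setD1P[e3 eE]]]; apply/negP => pe.
  by case: (pI _ eE pe) => h; [move/eqP: e3|move/eqP: e2].
have qI0 : isolated E0 q.
  apply/isolatedP => e /setD1P[e1 /setD1P[e2 /setD1P[e3 eE]]]; apply/negP => pe.
  by case: (qI _ eE pe) => h; [move/eqP: e3|move/eqP: e1].
have xI0 : isolated E0 x.
  by apply/isolatedP => e /(fintype.subsetP sE0); move/isolatedP: xE; exact.
have nX Z : X Z -> `|Z - M| <= r -> False by move=> hX hZ; exact: farN farX hZ hX.
have m1 := drawn_move dD3 pI0 (farN _ _ farX S1le).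
set X1 := (_ `|` _) in m1.
have X1S2 : ~ X1 S2 by move=> [[/nX/(_ S2le)]|/esym].
have m2 := drawn_move m1 qI0 X1S2.
set X2 := (_ `|` _) in m2.
have X2V : ~ X2 V by move=> [[[[/nX/(_ Vr)]|/esym]]|/esym].
have m3 := drawn_move m2 xI0 X2V.
set X3 := (_ `|` _) in m3; set pos' := upd _ x V in m3.
have p'p : pos' p = S1 by rewrite /pos' updN 1?eq_sym // updN // updE.
have p'q : pos' q = S2 by rewrite /pos' updN 1?eq_sym // updE.
have p'x : pos' x = V by rewrite /pos' updE.
have p'a : pos' a = pos a by rewrite /pos' !updN // eq_sym.
have p'b : pos' b = pos b by rewrite /pos' !updN // eq_sym.
have X3P z : X3 z -> [\/ X z /\ z <> pos p /\ z <> pos q, z = S1, z = S2 | z = V].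
  move=> [[[[[[Xz zp]|->] zq]|->] _]|->]; [|by constructor 2|by constructor 3|by constructor 4].
  constructor 1; split=> //; split=> // h; apply: zq; rewrite h /= updN // eq_sym //.
pose L1 := Ja `|` [set pos p] `|` K1; pose L2 := Jb `|` [set pos q] `|` K2.
have aL1 : open_arc (pos' p) (pos' a) L1.
  rewrite p'p p'a; apply: arc_sym; apply: arc_cat (arc_sym aJa) (arc_sym aK1) _ _ _ _.
  - by move=> h; apply: (near a S1).
  - by move=> /KJ1'; exact: Jp.
  - by move=> /farA; rewrite ltNge S1le.
  - by move=> z /JaJ[_ nJ] /KJ1'.
have aL2 : open_arc (pos' q) (pos' b) L2.
  rewrite p'q p'b; apply: arc_sym; apply: arc_cat (arc_sym aJb) (arc_sym aK2) _ _ _ _.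
  - by move=> h; apply: (near b S2).
  - by move=> /KJ2'; exact: Jp.
  - by move=> /farB; rewrite ltNge S2le.
  - by move=> z /JbJ[[_ nJ] _] /KJ2'.
have farL1 z : L1 z -> r < `|z - M| by move=> [[/farA|->]|/farK1].
have farL2 z : L2 z -> r < `|z - M| by move=> [[/farB|->]|/farK2].
have far3 z : r < `|z - M| -> ~ (X z /\ z <> pos p /\ z <> pos q) -> ~ X3 z.
  move=> zr nXz /X3P[//|zS|zS|zS]; move: zr; rewrite zS ltNge.
  - by rewrite S1le.
  - by rewrite S2le.
  - by rewrite Vr.
have L1X z : L1 z -> ~ X3 z.
  move=> Lz; apply: far3; first exact: farL1.
  move=> [/XJ[nJ nJa nJb] [zp zq]]; case: Lz => [[//|//]|/KJ1'//].
have L2X z : L2 z -> ~ (X3 `|` L1) z.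
  move=> Lz [|].
    apply: far3; first exact: farL2.
    by move=> [/XJ[nJ nJa nJb] [zp zq]]; case: Lz => [[//|//]|/KJ2'//].
  move=> L1z; case: Lz => [[Jz|zq]|Kz].
  - have [[_ nJ] nJa] := JbJ _ Jz.
    by case: L1z => [[//|zp]|/KJ1'//]; apply: (Jbp p); rewrite -zp.
  - case: L1z => [[Jz|zp]|Kz].
    + by apply: (Jap q); rewrite -zq.
    + by move: pq; rewrite (drawn_inj dE (etrans (esym zp) zq)) eqxx.
    + by apply: (Jp q); apply: KJ1'; rewrite -zq.
  - case: L1z => [[Jz|zp]|Kz'].
    + by have [_] := JaJ _ Jz; apply; exact: KJ2'.
    + by apply: (Jp p); apply: KJ2'; rewrite -zp.
    + by apply: (J12 z); [exact: KJ1|exact: KJ2].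
have d1 := drawn_add m3 aL1 L1X.
have d2 := drawn_add d1 aL2 L2X.
have seg_neq (P Q z : R * R) : P <> Q -> segment P Q z -> z <> P /\ z <> Q.
  move=> PQ hz; have [h1 h2] := arc_ends (arc_segment PQ).
  by split => zE; [apply: h1; rewrite -{2}zE|apply: h2; rewrite -{2}zE].
have inside z : `|z - M| <= r -> z <> S1 -> z <> S2 -> z <> V ->
    ~ ((X3 `|` L1) `|` L2) z.
  move=> zr z1 z2 zV [[/X3P[[Xz _]|//|//|//]|/farL1]|/farL2]; rewrite ?ltNge ?zr //.
  exact: (nX z).
have aS12 : open_arc (pos' p) (pos' q) (segment S1 S2).
  by rewrite p'p p'q; exact: arc_segment.
have d3 := drawn_add d2 aS12.
have {}d3 := d3 _; move: d3; set Y2 := (_ `|` L2) => d3.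
have h3 z : segment S1 S2 z -> ~ Y2 z.
  move=> hz; have [z1 z2] := seg_neq _ _ _ S12 hz.
  apply: inside => //; first exact: segment_in_ball hz.
  by move=> zV; apply: (apex_notin_side Vdet); rewrite -zV.
have {}d3 := d3 h3.
have aS1V : open_arc (pos' p) (pos' x) (segment S1 V).
  by rewrite p'p p'x; exact: arc_segment.
have h4 z : segment S1 V z -> ~ (Y2 `|` segment S1 S2) z.
  move=> hz [|hz']; last exact: sides_disjoint Vdet hz' hz.
  have [z1 z2] := seg_neq _ _ _ S1V hz.
  apply: inside => //; first exact: segment_in_ball hz.
  by move=> zV; apply: (apex_notin_side (det3C Vdet)); rewrite -zV.
have d4 := drawn_add d3 aS1V h4.
have aVS2 : open_arc (pos' x) (pos' q) (segment V S2).
  by rewrite p'q p'x; exact/arc_segment/nesym.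
have h5 z : segment V S2 z -> ~ (Y2 `|` segment S1 S2 `|` segment S1 V) z.
  move=> hz [[|hz']|hz'].
  - have [z1 z2] := seg_neq _ _ _ (nesym S2V) hz.
    apply: inside => //; first exact: segment_in_ball hz.
    by move=> zV; apply: (apex_notin_side (det3R Vdet)); rewrite -zV; exact: segment_sym.
  - exact: sides_disjoint (det3R Vdet) (segment_sym hz) (segment_sym hz').
  - exact: sides_disjoint (det3R (det3R Vdet)) (segment_sym hz') hz.
have d5 := drawn_add d4 aVS2 h5.
(* The three edges erased at the start have been redrawn as [segment S1 S2], [L1] and [L2], so all
   of [E] is present again. *)
exists pos'; apply: drawn_sub d5 _ _ => //.
apply/fintype.subsetP => e; rewrite !inE => /or3P[->|->|eE]; rewrite ?orbT //.
rewrite eE andbT; case: (e == [set p; q]%SET); case: (e == [set p; a]%SET);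
  by case: (e == [set q; b]%SET); rewrite ?orbT.
Qed.

End parallel.

(** * Reductions and pairs that can be joined *)

Section reduction.
Variables (R : realType) (T : finType).
Implicit Types (E F : {set {set T}}) (e f : {set T}) (W : {set T}) (a b c p q u v w x : T).

Definition incident E v := [set e in E | v \in e]%SET.
Definition degree E v := #|incident E v|.

Lemma degree0P E v : reflect (isolated E v) (degree E v == 0)%N.
Proof.
rewrite cards_eq0; apply: (iffP eqP) => [h|/isolatedP h].
  apply/isolatedP => e eE; apply/negP => ve.
  by have : e \in incident E v by [rewrite inE eE]; rewrite h inE.
by apply/setP => e; rewrite !inE; apply/negP => /andP[/h/negP].
Qed.

Lemma degree1P E v : planarE R E -> degree E v = 1%N -> exists2 w,
  [set v; w]%SET \in E & forall e, e \in E -> v \in e -> e = [set v; w]%SET.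
Proof.
move=> pE /eqP/cards1P[e h].
have : e \in incident E v by rewrite h inE.
rewrite inE => /andP[eE ve]; have [y [z [yz eyz]]] := planarE_simple pE eE.
have u f : f \in E -> v \in f -> f = e.
  by move=> fE vf; apply/set1P; rewrite -h inE fE.
have [w ew] : exists w, e = [set v; w]%SET.
  move: ve; rewrite eyz !inE => /orP[]/eqP ->; first by exists z.
  by exists y; rewrite finset.setUC.
by exists w; rewrite -ew // => f fE vf; exact: u.
Qed.

Lemma degree2P E v b : planarE R E -> degree E v = 2%N -> [set v; b]%SET \in E ->
  exists a, [/\ a != b, [set v; a]%SET \in E &
    forall e, e \in E -> v \in e -> e = [set v; b]%SET \/ e = [set v; a]%SET].
Proof.
move=> pE /eqP/cards2P[e [f [ef h]]] vbE.
have [g [gvb [gE vg hg]]] : exists g, g != [set v; b]%SET /\ [/\ g \in E, v \in g &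
    forall e, e \in E -> v \in e -> e = [set v; b]%SET \/ e = g].
  have he : e \in incident E v by rewrite h !inE eqxx.
  have hf : f \in incident E v by rewrite h !inE eqxx orbT.
  have hb : [set v; b]%SET \in incident E v by rewrite inE vbE !inE eqxx.
  have K k : k \in E -> v \in k -> k = e \/ k = f.
    move=> kE vk; have : k \in incident E v by rewrite inE kE.
    by rewrite h !inE => /orP[]/eqP->; auto.
  move: he hf; rewrite !inE => /andP[eE ve] /andP[fE vf].
  move: hb; rewrite h !inE => /orP[]/eqP ->.
    by exists f; rewrite eq_sym.
  by exists e; split => //; split => // k kE vk; case: (K k kE vk); auto.
have [y [z [yz gyz]]] := planarE_simple pE gE.
have [a ga] : exists a, g = [set v; a]%SET.
  move: vg; rewrite gyz !inE => /orP[]/eqP ->; first by exists z.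
  by exists y; rewrite finset.setUC.
exists a; rewrite -ga; split => //.
by apply: contraNneq gvb; rewrite ga => ->.
Qed.

Lemma planarE_subP E F : planarE R E -> (forall e, e \in F -> e \in E) -> planarE R F.
Proof. by move=> pE h; apply: planarE_sub pE _; apply/fintype.subsetP. Qed.

Lemma imset_set2 (f : T -> T) a b : (f @: [set a; b] = [set f a; f b])%SET.
Proof. by rewrite imsetU !imset_set1. Qed.

Lemma imset_tperm_id a b e : a \notin e -> b \notin e -> (tperm a b @: e)%SET = e.
Proof.
move=> ae be; rewrite -[RHS]imset_id; apply: eq_in_imset => y ye.
by rewrite tpermD //; apply: contraNneq ae => -> || apply: contraNneq be => ->.
Qed.

(* A path through a spare vertex rather than an edge, since [u] and [v] may be adjacent. *)
Definition joinable x E u v := planarE R ([set u; x] |: ([set x; v] |: E))%SET.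

Lemma joinable_sym x E u v : joinable x E u v -> joinable x E v u.
Proof.
by rewrite /joinable finset.setUCA [ [set x; v]%SET]finset.setUC [ [set u; x]%SET]finset.setUC.
Qed.

(* [cl] sends a vertex to its image in the graph left after deleting leaves, suppressing
   one of two adjacent vertices of degree 2 and deleting pendant triangles. The final
   graph satisfies [|E| >= 2 n2] and [2|E| >= 2 n2 + 3 n3], where [n2] and [n3] count the
   vertices of degree 2 and at least 3; hence the coefficients 5 and 6. *)
Definition reducible x E W := exists (I : {set T}) (cl : T -> T),
  [/\ I \subset W,
      forall i j, i \in I -> j \in I -> i != j -> joinable x E i j,
      forall u v, u \in W -> v \in W -> u != v -> cl u = cl v -> joinable x E u v,
      forall u, u \in W -> cl u \in W &
      (#|cl @: W| + 5 * #|W| <= 5 * #|E| + 6 * #|I|)%N].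

Lemma reducible_merge x E F W v b : v \in W -> b \in W -> b != v ->
  #|E| = #|F|.+1 ->
  (forall p q, p \in W -> q \in W -> p != v -> q != v -> joinable x F p q -> joinable x E p q) ->
  (forall q, q \in W -> q != v -> q != b -> joinable x F b q -> joinable x E v q) ->
  joinable x E v b -> reducible x F (W :\ v) -> reducible x E W.
Proof.
move=> vW bW bv EF h1 h2 h3 [I [cl [IW hI hcl clW card]]].
pose cl' u := if u == v then cl b else cl u.
have bW' : b \in W :\ v by rewrite in_setD1 bv.
exists I, cl'; split.
- exact: fintype.subset_trans IW (finset.subsetDl _ _).
- move=> i j iI jI ij.
  have /setD1P[iv iW] := fintype.subsetP IW _ iI.
  have /setD1P[jv jW] := fintype.subsetP IW _ jI.
  by apply: h1 => //; exact: hI.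
- have K u : u \in W -> u != v -> cl b = cl u -> joinable x E v u.
    move=> uW uv bu; have [->//|ub] := eqVneq u b.
    apply: h2 => //; apply: hcl => //; first by rewrite in_setD1 uv.
    by rewrite eq_sym.
  move=> u w uW wW uw; rewrite /cl'; case: eqVneq => [uE|uv]; case: eqVneq => [wE|wv].
  + by move: uw; rewrite uE wE eqxx.
  + by rewrite uE => /K; apply.
  + by rewrite wE => /esym /K h; apply: joinable_sym; exact: h.
  + by move=> h; apply: h1 => //; apply: hcl => //; rewrite in_setD1 ?uv ?wv.
- move=> u uW; rewrite /cl'; case: eqVneq => [uE|uv].
    by have /setD1P[] := clW _ bW'.
  have uW' : u \in W :\ v by rewrite in_setD1 uv.
  by have /setD1P[] := clW _ uW'.
- have : (#|cl' @: W| <= #|cl @: (W :\ v)|)%N.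
    apply/subset_leq_card/fintype.subsetP => _ /imsetP[u uW ->].
    rewrite /cl'; case: eqVneq => [uE|uv]; first exact: imset_f.
    by apply: imset_f; rewrite in_setD1 uv.
  by rewrite (cardsD1 v W) vW; lia.
Qed.

Lemma isolatedU1 E v a b : v != a -> v != b -> isolated E v -> isolated ([set a; b]%SET |: E) v.
Proof.
move=> va vb /isolatedP h; apply/isolatedP => e /setU1P[->|/h//].
by rewrite !inE negb_or va.
Qed.

Lemma isolated_join E v p x q : v != p -> v != x -> v != q -> isolated E v ->
  isolated ([set p; x] |: ([set x; q] |: E))%SET v.
Proof. by move=> vp vx vq vE; do 2![apply: isolatedU1 => //]. Qed.

(** The leaf enters the class of its neighbour [w]: subdividing the edge [w x] of a path [w x q] by
    [v] yields [w v x q], which contains both the leaf edge and a path from [v] through [x] to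
    [q]. *)
Lemma reducible_leaf x E W v : planarE R E -> (forall e, e \in E -> e \subset W) ->
  x \notin W -> v \in W -> degree E v = 1%N ->
  (forall F, planarE R F -> (forall e, e \in F -> e \subset W :\ v) -> reducible x F (W :\ v)) ->
  reducible x E W.
Proof.
move=> pE EW xW vW /(degree1P pE)[w vwE vu] IH.
have vw := planarE_neq pE vwE.
have wW : w \in W by apply: (fintype.subsetP (EW _ vwE)); rewrite !inE eqxx orbT.
have xN u : u \in W -> x != u by move=> uW; apply: contraNneq xW => ->.
have xE : isolated E x.
  by apply/isolatedP => e /EW /fintype.subsetP eW; apply: contraNN xW => /eW.
pose F := E :\ [set v; w]%SET.
have pF : planarE R F by apply: planarE_sub pE (finset.subsetDl _ _).
have vF : isolated F v.
  apply/isolatedP => e /setD1P[ne eE]; apply: contraNN ne => ve.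
  by apply/eqP; exact: vu.
have xF : isolated F x.
  by apply/isolatedP => e /setD1P[_]; move/isolatedP: xE; exact.
have EF e : e \in E -> e = [set v; w]%SET \/ e \in F.
  by move=> eE; case: (eqVneq e [set v; w]%SET) => [|ne]; [left|right; rewrite in_setD1 ne].
apply: (@reducible_merge x E F W v w) => //; first by rewrite eq_sym.
- by rewrite (cardsD1 [set v; w]%SET E) vwE.
- move=> p q pW qW pv qv /planarE_pendant -/(_ v w) h.
  apply: planarE_subP (h _ vw) _.
    by apply: isolated_join => //; rewrite eq_sym ?xN.
  move=> e /setU1P[->|/setU1P[->|/EF[->|eF]]]; rewrite !inE ?eqxx ?orbT //.
  by rewrite -/(F) in eF *; move: eF; rewrite !inE => /andP[-> ->]; rewrite !orbT.
- move=> q qW qv qw pj.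
  have wx : [set w; x]%SET \in ([set w; x] |: ([set x; q] |: F))%SET by rewrite !inE eqxx.
  have vI : isolated ([set w; x] |: ([set x; q] |: F))%SET v.
    by apply: isolated_join => //; rewrite eq_sym ?xN.
  apply: planarE_subP (planarE_subdivide pj wx vI) _ => e.
  have wxF f : x \notin f -> f != [set w; x]%SET.
    by apply: contraNneq => ->; rewrite !inE eqxx orbT.
  move=> /setU1P[->|/setU1P[->|/EF[->|eF]]]; rewrite !inE ?eqxx ?orbT //.
  + rewrite orbA; apply/orP; right; apply/andP; split => //.
    apply/eqP => /set2_eq; rewrite xN // => /(_ isT)[[h _]|[h _]].
      by move: (xN _ wW); rewrite h eqxx.
    by move: qw; rewrite h eqxx.
  + by rewrite finset.setUC eqxx.
  + have := eF; rewrite /F !inE => /andP[-> ->]; rewrite wxF ?orbT //.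
    by move/isolatedP: xF; exact.
- have := planarE_triangle pF vF xF vw (xN _ wW) _; rewrite eq_sym xN // => /(_ isT) h.
  apply: planarE_subP h _ => e; rewrite /F !inE => /or3P[/eqP->|/eqP->|eE].
  + by rewrite eqxx !orbT.
  + by rewrite [ [set w; x]%SET]finset.setUC eqxx !orbT.
  + by rewrite eE andbT; case: (e == [set v; w]%SET); rewrite ?orbT.
- apply: IH => // e /setD1P[ne eE]; apply/fintype.subsetP => y ye.
  rewrite in_setD1 (fintype.subsetP (EW _ eE)) // andbT.
  by apply: contraNneq ne => yv; apply/eqP/vu => //; rewrite -yv.
Qed.

End reduction.

Section reduction_steps.
Variables (R : realType) (T : finType).
Implicit Types (E F : {set {set T}}) (e f : {set T}) (W : {set T}) (a b c p q u v w x : T).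

(** The path [a v b c] is shortened to [a b c]. It can be subdivided again on either side of [b],
    and this symmetry lets [v] enter the class of [b]. That [a] and [c] differ ensures that the edge
    [a b] is new, so exactly one edge is lost. *)
Lemma reducible_suppress x E W v a b c : planarE R E -> (forall e, e \in E -> e \subset W) ->
  x \notin W -> [set v; b]%SET \in E -> [set v; a]%SET \in E -> [set b; c]%SET \in E ->
  (forall e, e \in E -> v \in e -> e = [set v; b]%SET \/ e = [set v; a]%SET) ->
  (forall e, e \in E -> b \in e -> e = [set b; v]%SET \/ e = [set b; c]%SET) ->
  a != b -> c != v -> a != c ->
  (forall F, planarE R F -> (forall e, e \in F -> e \subset W :\ v) -> reducible R x F (W :\ v)) ->
  reducible R x E W.
Proof.
move=> pE EW xW vbE vaE bcE vu bu ab cv ac IH.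
have vb := planarE_neq pE vbE; have va := planarE_neq pE vaE; have bc := planarE_neq pE bcE.
have inW y z : [set y; z]%SET \in E -> y \in W /\ z \in W.
  by move=> /EW/fintype.subsetP h; split; apply: h; rewrite !inE eqxx ?orbT.
have [vW bW] := inW _ _ vbE; have [_ aW] := inW _ _ vaE; have [_ cW] := inW _ _ bcE.
have xN u : u \in W -> x != u by move=> uW; apply: contraNneq xW => ->.
have xE : isolated E x.
  by apply/isolatedP => e /EW /fintype.subsetP eW; apply: contraNN xW => /eW.
have abE : [set a; b]%SET \notin E.
  apply/negP => abE; have b_ab : b \in [set a; b]%SET by rewrite !inE eqxx orbT.
  have bv : b != v by rewrite eq_sym.
  case: (bu _ abE b_ab) => /esym/set2_eq.
    by case/(_ bv) => -[h _]; [rewrite h eqxx in ab|rewrite h eqxx in va].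
  by case/(_ bc) => -[h _]; [rewrite h eqxx in ab|rewrite h eqxx in ac].
pose F := [set a; b]%SET |: (E :\ [set v; a]%SET :\ [set v; b]%SET).
have pF : planarE R F by apply: planarE_suppress => // e eE ve; case: (vu _ eE ve); auto.
have FE f : f \in E -> v \notin f -> f \in F.
  move=> fE vf; rewrite /F !inE fE andbT; apply/orP; right.
  by apply/andP; split; apply: contraNneq vf => ->; rewrite !inE eqxx.
have EF e : e \in E -> [\/ e = [set v; b]%SET, e = [set v; a]%SET | v \notin e /\ e \in F].
  move=> eE; case: (boolP (v \in e)) => ve; last by constructor 3; split=> //; exact: FE.
  by case: (vu _ eE ve) => ->; [constructor 1|constructor 2].
have vF : isolated F v.
  apply/isolatedP => e /setU1P[->|/setD1P[n1 /setD1P[n2 eE]]].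
    by rewrite !inE negb_or va vb.
  by apply/negP => ve; case: (vu _ eE ve) => h; [move: n1|move: n2]; rewrite h eqxx.
have xF : isolated F x.
  apply/isolatedP => e /setU1P[->|/setD1P[n1 /setD1P[n2 eE]]].
    by rewrite !inE negb_or !xN.
  by move/isolatedP: xE; exact.
have spN y (f : {set T}) : x \notin f -> f != [set y; x]%SET.
  by apply: contraNneq => ->; rewrite !inE eqxx orbT.
have cF : #|E| = #|F|.+1.
  rewrite cardsU1 !inE (negPf abE) andbF /= andbF add1n.
  have h1 := cardsD1 [set v; a]%SET E; rewrite vaE in h1.
  have h2 := cardsD1 [set v; b]%SET (E :\ [set v; a]%SET).
  have h3 : [set v; b]%SET \in E :\ [set v; a]%SET.
    rewrite !inE vbE andbT; apply/eqP => /set2_eq/(_ vb)[[_ h]|[h _]].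
      by rewrite h eqxx in ab.
    by rewrite h eqxx in vb.
  by rewrite h1 h2 h3.
have FW e : e \in F -> e \subset W :\ v.
  move=> /setU1P[->|/setD1P[n1 /setD1P[n2 eE]]]; apply/fintype.subsetP => y.
    by rewrite !inE => /orP[]/eqP->; rewrite ?aW ?bW eq_sym ?va ?vb.
  move=> ye; rewrite in_setD1 (fintype.subsetP (EW _ eE)) // andbT.
  by apply/eqP => yv; case: (vu _ eE) => [|h|h]; rewrite -?yv //; [move: n1|move: n2]; rewrite h eqxx.
have abF : [set a; b]%SET \in F by rewrite /F !inE eqxx.
clearbody F.
apply: (@reducible_merge R T x E F W v b) => //; first by rewrite eq_sym.
- move=> p q pW qW pv qv pj.
  have abP : [set a; b]%SET \in ([set p; x] |: ([set x; q] |: F))%SET.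
    by rewrite !in_setU1 abF !orbT.
  have vI : isolated ([set p; x] |: ([set x; q] |: F))%SET v.
    by apply: isolated_join => //; rewrite eq_sym ?xN.
  apply: planarE_subP (planarE_subdivide pj abP vI) _ => e.
  have xab : x \notin [set a; b]%SET by rewrite !inE negb_or !xN.
  have n1 : [set p; x]%SET != [set a; b]%SET by rewrite eq_sym spN.
  have n2 : [set x; q]%SET != [set a; b]%SET by rewrite finset.setUC eq_sym spN.
  move=> /setU1P[->|/setU1P[->|eE]]; first by rewrite !inE eqxx n1 !orbT.
    by rewrite !inE eqxx n2 !orbT.
  case: (EF _ eE) => [->|->|[ve eF]]; first by rewrite !inE eqxx orbT.
    by rewrite [ [set v; a]%SET]finset.setUC !inE eqxx.
  have eab : e != [set a; b]%SET by apply: contraNneq abE => <-.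
  by rewrite !in_setU1 in_setD1 eab !in_setU1 eF !orbT.
- move=> q qW qv qb pj.
  pose P1 := ([set b; x] |: ([set x; q] |: F))%SET; have pP1 : planarE R P1 := pj.
  have P1bx : [set b; x]%SET \in P1 by rewrite !inE eqxx.
  have P1xq : [set x; q]%SET \in P1 by rewrite !inE eqxx orbT.
  have P1F e : e \in F -> e \in P1 by move=> eF; rewrite !in_setU1 eF !orbT.
  have vI : isolated P1 v by apply: isolated_join => //; rewrite eq_sym ?xN.
  clearbody P1.
  have bcP : [set b; c]%SET \in P1.
    by apply/P1F/FE => //; rewrite !inE negb_or vb eq_sym.
  pose P2 := ([set b; v] |: ([set v; c] |: (P1 :\ [set b; c])))%SET.
  have pP2 : planarE R P2 := planarE_subdivide pP1 bcP vI.
  have P2bv : [set b; v]%SET \in P2 by rewrite !inE eqxx.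
  have P2vc : [set v; c]%SET \in P2 by rewrite !inE eqxx orbT.
  have P2P e : e \in P1 -> e != [set b; c]%SET -> e \in P2.
    by move=> eP ne; rewrite !in_setU1 in_setD1 ne eP !orbT.
  clearbody P2.
  have xbc : x \notin [set b; c]%SET by rewrite !inE negb_or !xN.
  have xb := xN _ bW; have xv := xN _ vW.
  (* [P2] was obtained by subdividing on the side of [c]: it contains the path [a b v c], with the
     path through [x] starting at [b]. Exchanging the names of [b] and [v] restores [a v b c] and
     makes that path start at [v]. *)
  apply: planarE_map (@perm_inj _ (tperm b v)) _ pP2 => e.
  have tx : tperm b v x = x by rewrite tpermD // eq_sym.
  have tq : tperm b v q = q by rewrite tpermD // eq_sym.
  have ta : tperm b v a = a by rewrite tpermD // eq_sym.
  have tc : tperm b v c = c by rewrite tpermD // eq_sym.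
  move=> /setU1P[->|/setU1P[->|eE]].
  + by rewrite imset_set2 tpermR tx P2P // eq_sym spN.
  + by rewrite imset_set2 tq tx P2P // [ [set x; q]%SET]finset.setUC eq_sym spN.
  + case: (EF _ eE) => [->|->|[ve eF]].
    * by rewrite imset_set2 tpermR tpermL.
    * rewrite imset_set2 tpermR ta finset.setUC P2P ?P1F //.
      by apply: contraNneq abE => ->.
    * case: (boolP (b \in e)) => be.
        case: (bu _ eE be) => ->.
          by rewrite imset_set2 tpermL tpermR finset.setUC.
        by rewrite imset_set2 tpermL tc.
      rewrite imset_tperm_id // P2P ?P1F //.
      by apply: contraNneq be => ->; rewrite !inE eqxx.
- have bu' e : e \in E -> b \in e -> e = [set v; b]%SET \/ e = [set b; c]%SET.
    by move=> eE be; rewrite [ [set v; b]%SET]finset.setUC; exact: bu.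
  exact: (planarE_parallel pE vbE vaE bcE ab cv xE vu bu').
- exact: IH.
Qed.

(** Two vertices and three edges go, and [v] and [b] become classes of their own: the left side
    grows by 2 + 5 * 2 = 12, the right side by at least 15. That [cl] maps the smaller vertex set
    into itself keeps the two new classes apart from the old ones. *)
Lemma reducible_triangle x E W v a b : planarE R E -> (forall e, e \in E -> e \subset W) ->
  x \notin W -> [set v; b]%SET \in E -> [set v; a]%SET \in E -> [set b; a]%SET \in E ->
  (forall e, e \in E -> v \in e -> e = [set v; b]%SET \/ e = [set v; a]%SET) ->
  (forall e, e \in E -> b \in e -> e = [set b; v]%SET \/ e = [set b; a]%SET) ->
  (forall F, planarE R F -> (forall e, e \in F -> e \subset W :\ v :\ b) ->
     reducible R x F (W :\ v :\ b)) ->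
  reducible R x E W.
Proof.
move=> pE EW xW vbE vaE baE vu bu IH.
have vb := planarE_neq pE vbE; have va := planarE_neq pE vaE; have ba := planarE_neq pE baE.
have inW y z : [set y; z]%SET \in E -> y \in W /\ z \in W.
  by move=> /EW/fintype.subsetP h; split; apply: h; rewrite !inE eqxx ?orbT.
have [vW bW] := inW _ _ vbE; have [_ aW] := inW _ _ vaE.
have xN u : u \in W -> x != u by move=> uW; apply: contraNneq xW => ->.
pose F := [set e in E | (v \notin e) && (b \notin e)]%SET.
have FE : F \subset E by apply/fintype.subsetP => e; rewrite inE => /andP[].
have EF e : e \in E -> [\/ e = [set v; b]%SET, e = [set v; a]%SET, e = [set b; a]%SET | e \in F].
  move=> eE; case: (boolP (v \in e)) => ve.
    by case: (vu _ eE ve) => ->; [constructor 1|constructor 2].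
  case: (boolP (b \in e)) => be; last by constructor 4; rewrite inE eE ve be.
  by case: (bu _ eE be) => ->; [constructor 1; rewrite finset.setUC|constructor 3].
have nE : (#|F| + 3 <= #|E|)%N.
  have s : [set [set v; b]; [set v; a]; [set b; a]]%SET \subset E :\: F.
    apply/fintype.subsetP => e; rewrite !inE => /orP[/orP[]|] /eqP ->;
    by rewrite !inE ?eqxx ?orbT //= ?andbF ?vbE ?vaE ?baE.
  have c3 : #|[set [set v; b]; [set v; a]; [set b; a]]%SET| = 3%N.
    have n1 : [set v; b]%SET != [set v; a]%SET.
      by apply/eqP => /set2_eq/(_ vb)[[_ h]|[h _]]; [rewrite h eqxx in ba|rewrite h eqxx in vb].
    have n2 : [set b; a]%SET != [set v; b]%SET.
      apply/eqP => /set2_eq/(_ ba)[[h _]|[h _]]; [by rewrite h eqxx in vb|by rewrite h eqxx in va].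
    have n3 : [set b; a]%SET != [set v; a]%SET.
      apply/eqP => /set2_eq/(_ ba)[[h _]|[h _]]; [by rewrite h eqxx in vb|by rewrite h eqxx in va].
    by rewrite finset.setUC cardsU1 cards2 n1 !inE negb_or n2 n3.
  have := subset_leq_card s; rewrite c3 cardsD (finset.setIidPr FE).
  by move: (subset_leq_card FE); move: #|F| #|E| => nF nE; clear; lia.
have pF : planarE R F by exact: planarE_sub pE FE.
have FW e : e \in F -> e \subset W :\ v :\ b.
  rewrite inE => /and3P[eE ve be]; apply/fintype.subsetP => y ye.
  rewrite !inE (fintype.subsetP (EW _ eE)) // andbT.
  by apply/andP; split; [apply: contraNneq be => <-|apply: contraNneq ve => <-].
have vF : isolated F v by apply/isolatedP => e; rewrite inE => /and3P[].
have bF : isolated F b by apply/isolatedP => e; rewrite inE => /and3P[].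
have [I [cl [IW hI hcl clW card]]] := IH _ pF FW.
have lift p q : p \in W :\ v :\ b -> q \in W :\ v :\ b -> joinable R x F p q -> joinable R x E p q.
  rewrite !inE => /and3P[pb pv pW] /and3P[qb qv qW] pj.
  have vI : isolated ([set p; x] |: ([set x; q] |: F))%SET v.
    by apply: isolated_join => //; rewrite eq_sym ?xN.
  have bI : isolated ([set p; x] |: ([set x; q] |: F))%SET b.
    by apply: isolated_join => //; rewrite eq_sym ?xN.
  apply: planarE_subP (planarE_triangle pj vI bI va ba vb) _ => e.
  move=> /setU1P[->|/setU1P[->|/EF[->|->|->|eF]]]; rewrite !in_setU1 ?eqxx ?orbT //.
    by rewrite [ [set b; a]%SET]finset.setUC eqxx orbT.
  by rewrite eF !orbT.
pose cl' u := if (u == v) || (u == b) then u else cl u.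
have W' u : u \in W -> ~~ ((u == v) || (u == b)) -> u \in W :\ v :\ b.
  by rewrite negb_or => uW /andP[uv ub]; rewrite !inE uv ub.
exists I, cl'; split.
- by apply: fintype.subset_trans IW _; rewrite !(fintype.subset_trans (finset.subsetDl _ _)) ?finset.subsetDl.
- move=> i j iI jI ij; apply: lift; [exact: fintype.subsetP IW _ iI|exact: fintype.subsetP IW _ jI|].
  exact: hI.
- move=> u w uW wW uw; rewrite /cl'; case: ifPn => hu; case: ifPn => hw.
  + by move=> h; rewrite h eqxx in uw.
  + by move=> h; have := clW _ (W' _ wW hw); rewrite -h !inE; case/orP: hu => ->; rewrite ?andbF.
  + by move=> h; have := clW _ (W' _ uW hu); rewrite h !inE; case/orP: hw => ->; rewrite ?andbF.
  + by move=> h; apply: lift; rewrite ?W' //; apply: hcl => //; exact: W'.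
- move=> u uW; rewrite /cl'; case: ifPn => // hu.
  by have := clW _ (W' _ uW hu); rewrite !inE => /and3P[].
- have : (#|cl' @: W| <= #|v |: (b |: cl @: (W :\ v :\ b))|)%N.
    apply/subset_leq_card/fintype.subsetP => _ /imsetP[u uW ->]; rewrite /cl'.
    case: ifPn => [/orP[]/eqP->|hu]; rewrite !in_setU1 ?eqxx ?orbT //.
    by rewrite (imset_f cl (W' _ uW hu)) !orbT.
  rewrite !cardsU1.
  have h1 := cardsD1 v W; have h2 := cardsD1 b (W :\ v).
  rewrite vW in h1; rewrite !inE eq_sym vb bW in h2.
  rewrite h1 h2; case: (_ \notin _); case: (_ \notin _); move: nE card;
  move: #|F| #|E| #|I| #|W :\ v :\ b| #|cl @: (W :\ v :\ b)| #|cl' @: W|; clear; lia.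
Qed.

Lemma sum_degree E W : (forall e, e \in E -> e \subset W) -> (forall e, e \in E -> #|e| = 2%N) ->
  (\sum_(v in W) degree E v = 2 * #|E|)%N.
Proof.
move=> EW E2; under eq_bigr => v _ do rewrite /degree -sum1_card.
rewrite (exchange_big_dep (mem E)) /= => [|v e _]; last by rewrite inE => /andP[].
rewrite mulnC -sum_nat_const; apply: eq_bigr => e eE.
rewrite -(E2 _ eE) -sum1_card; apply: eq_bigl => v; rewrite inE eE /=.
by apply/andP/idP => [[]//|ve]; split=> //; exact: fintype.subsetP (EW _ eE) _ ve.
Qed.

(** Nothing is left to merge: [cl] is the identity, and [I] consists of the isolated vertices, any
    two of which can be joined through [x] by pendant edges. *)
Lemma reducible_base x E W : planarE R E -> (forall e, e \in E -> e \subset W) ->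
  x \notin W -> (forall v, v \in W -> degree E v != 1%N) ->
  (forall v b, degree E v = 2%N -> degree E b = 2%N -> [set v; b]%SET \notin E) ->
  reducible R x E W.
Proof.
move=> pE EW xW deg1 deg2.
have xN u : u \in W -> x != u by move=> uW; apply: contraNneq xW => ->.
have xE : isolated E x.
  by apply/isolatedP => e /EW /fintype.subsetP eW; apply: contraNN xW => /eW.
exists [set v in W | degree E v == 0%N]%SET, id; split => //.
- by apply/fintype.subsetP => v; rewrite inE => /andP[].
- move=> i j; rewrite !inE => /andP[iW /degree0P iI] /andP[jW /degree0P jI] ij.
  have h := planarE_pendant pE xE (xN _ jW).
  apply: planarE_pendant h _ _; last by rewrite eq_sym xN.
  by apply: isolatedU1 => //; rewrite eq_sym xN.
- by move=> u v _ _ uv h; rewrite h eqxx in uv.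
have E2 e : e \in E -> #|e| = 2%N by exact: planarE_card2 pE.
have s1 := sum_degree EW E2.
(* Each edge has at most one end of degree 2, so it is counted at most once in this sum. *)
have s2 : (\sum_(v in W) degree E v * (degree E v == 2%N) <= #|E|)%N.
  rewrite (eq_bigr (fun v => if degree E v == 2%N then degree E v else 0%N)); last first.
    by move=> v _; case: eqP; rewrite ?muln1 ?muln0.
  rewrite -big_mkcondr /=.
  under eq_bigr => v _ do rewrite /degree -sum1_card.
  rewrite (exchange_big_dep (mem E)) /= => [|v e _]; last by rewrite inE => /andP[].
  rewrite -sum1_card; apply: leq_sum => e eE; rewrite sum1dep_card.
  have [y [z [yz eyz]]] := planarE_simple pE eE.
  rewrite leqNgt; apply/negP => /card_gt1P[u [w [hu hw uw]]].
  move: hu hw; rewrite !inE eE /= => /andP[/andP[_ /eqP du] ue] /andP[/andP[_ /eqP dw] we].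
  have := deg2 _ _ du dw; suff -> : [set u; w]%SET = e by rewrite eE.
  move: ue we uw; rewrite eyz !inE => /orP[]/eqP-> /orP[]/eqP->; rewrite ?eqxx // finset.setUC //.
rewrite imset_id.
have -> : #|[set v in W | degree E v == 0%N]%SET| = (\sum_(v in W) (degree E v == 0%N))%N.
  by rewrite -sum1_card big_mkcond /= [RHS]big_mkcond; apply: eq_bigr => v _; rewrite inE; case: (v \in W).
(* The weight of each vertex is at least 6: it is 6 in degree 0, 4 + 2 in degree 2, and at least 6
   from degree 3 on. Summation gives 6 |W| <= 6 |I| + 4 |E| + |E|. *)
have : (\sum_(v in W) 6 <= \sum_(v in W) (6 * (degree E v == 0%N) + 2 * degree E v +
   degree E v * (degree E v == 2%N)))%N.
  apply: leq_sum => v vW; have := deg1 _ vW.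
  by case: (degree E v) => [|[|[|k]]] //=; clear; lia.
have z0 : (\sum_(v in W) 0 = 0)%N by rewrite big1.
rewrite sum_nat_const !big_split /= z0 s1; move: s2.
move: (\sum_(v in W) _ * _)%N (\sum_(v in W) (_ == _))%N #|W| #|E|; clear; lia.
Qed.

Lemma planarE_reducible x E W : planarE R E -> (forall e, e \in E -> e \subset W) ->
  x \notin W -> reducible R x E W.
Proof.
have [n] := ubnP #|W|; elim: n W E => // n IH W E Wn pE EW xW.
have inW y z : [set y; z]%SET \in E -> y \in W /\ z \in W.
  by move=> /EW/fintype.subsetP h; split; apply: h; rewrite !inE eqxx ?orbT.
have IH1 v : v \in W -> forall F, planarE R F -> (forall e, e \in F -> e \subset W :\ v) ->
    reducible R x F (W :\ v).
  move=> vW F pF FW; apply: IH => //; last by rewrite !inE negb_and xW orbT.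
  by rewrite (cardsD1 v) vW in Wn.
case: (pickP [pred v in W | degree E v == 1%N]) => [v /andP[/= vW /eqP d1]|d1].
  exact: reducible_leaf (IH1 v vW).
case: (pickP [pred vb : T * T | [&& degree E vb.1 == 2%N, degree E vb.2 == 2%N &
    [set vb.1; vb.2]%SET \in E]]) => [[v b] /= /and3P[/eqP dv /eqP db vbE]|d2]; last first.
  apply: reducible_base => // [v vW|v b dv db]; first by have := d1 v; rewrite /= vW /= => ->.
  by have := d2 (v, b); rewrite /= dv db /= => ->.
have [a [ab vaE vu]] := degree2P pE dv vbE.
have bvE : [set b; v]%SET \in E by rewrite finset.setUC.
have [c [cv bcE bu]] := degree2P pE db bvE.
have [vW bW] := inW _ _ vbE.
have [ac|ac] := eqVneq a c.
  subst c; apply: (@reducible_triangle x E W v a b) => // F pF FW.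
  apply: IH => //; last by rewrite !inE !negb_and xW !orbT.
  by rewrite (cardsD1 v) vW in Wn; apply: leq_ltn_trans (subset_leq_card (finset.subsetDl _ _)) _.
exact: (@reducible_suppress x E W v a b c _ _ _ _ _ _ _ _ _ _ _ (IH1 v vW)).
Qed.

End reduction_steps.

(** * Counting planar edge sets *)

Lemma double_count (A B : finType) (S : {set A}) (S' : {set B}) (r : A -> B -> bool) (c d : nat) :
  (forall a, a \in S -> (c <= #|[set b in S' | r a b]%SET|)%N) ->
  (forall b, b \in S' -> (#|[set a in S | r a b]%SET| <= d)%N) ->
  (#|S| * c <= #|S'| * d)%N.
Proof.
move=> hc hd; apply: (@leq_trans (\sum_(a in S) #|[set b in S' | r a b]%SET|)).
  by rewrite -sum_nat_const; apply: leq_sum.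
have -> : (\sum_(a in S) #|[set b in S' | r a b]%SET| =
           \sum_(b in S') #|[set a in S | r a b]%SET|)%N.
  under eq_bigr => a aS do rewrite -sum1_card.
  under [RHS]eq_bigr => b bS do rewrite -sum1_card.
  rewrite (exchange_big_dep (mem S')) /= => [|a b _]; last by rewrite inE => /andP[].
  by apply: eq_bigr => b bS; apply: eq_bigl => a; rewrite !inE bS.
by rewrite -sum_nat_const; apply: leq_sum.
Qed.

Lemma leq_card_fibers (A B : finType) (S : {set A}) (S' : {set B}) (f : A -> B) (d : nat) :
  (forall a, a \in S -> f a \in S') ->
  (forall b, b \in S' -> (#|[set a in S | f a == b]%SET| <= d)%N) ->
  (#|S| <= #|S'| * d)%N.
Proof.
move=> fS hd; rewrite -[#|S|]muln1.
apply: (@double_count _ _ S S' (fun a b => f a == b)) => // a aS.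
by apply/card_gt0P; exists (f a); rewrite inE fS ?eqxx.
Qed.

Lemma some_injective (T : Type) : injective (@Some T).
Proof. by move=> x y []. Qed.

Lemma planarE0 (R : realType) (T : finType) : planarE R (@finset.set0 {set T}).
Proof.
apply/planarE_drawn; exists (fun x => ((enum_rank x)%:R, 0)), (fun=> set0).
split => //; try by move=> e; rewrite inE.
- by move=> x y [] /eqP; rewrite eqr_nat => /eqP /val_inj /enum_rank_inj.
Qed.

Section addable.
Variables (R : realType) (T : finType).
Implicit Types (E F : {set {set T}}) (e f : {set T}) (u v : T) (k : nat).

Definition addable E : {set {set T}} :=
  [set e : {set T} | [&& e \notin E, #|e| == 2%N & `[< planarE R (e |: E) >]]]%SET.

Definition planar_sets k : {set {set {set T}}} :=
  [set E : {set {set T}} | (#|E| == k) && `[< planarE R E >]]%SET.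

Lemma planar_setsP k E : reflect (#|E| = k /\ planarE R E) (E \in planar_sets k).
Proof.
rewrite inE; apply: (iffP andP) => [[/eqP h /asboolP]|[h1 h2]] //.
by split; [exact/eqP|exact/asboolP].
Qed.

Lemma addableP E e : reflect [/\ e \notin E, #|e| = 2%N & planarE R (e |: E)] (e \in addable E).
Proof.
rewrite inE; apply: (iffP and3P) => [[h1 /eqP h2 /asboolP]|[h1 h2 h3]] //.
by split => //; [exact/eqP|exact/asboolP].
Qed.

Definition lift_edges E : {set {set option T}} := [set (Some @: e)%SET | e : {set T} in E]%SET.

(** Suppressing the spare vertex turns the path into the edge [u v]. *)
Lemma joinable_lift E u v : joinable R None (lift_edges E) (Some u) (Some v) -> u != v ->
  planarE R ([set u; v]%SET |: E).
Proof.
move=> pj uv.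
have NE (e : {set option T}) : e \in lift_edges E -> None \notin e.
  by move=> /imsetP[f fE ->]; apply/negP => /imsetP[].
have p1 : [set None; Some u]%SET \in ([set Some u; None] |: ([set None; Some v] |: lift_edges E))%SET.
  by rewrite finset.setUC !inE eqxx.
have p2 : [set None; Some v]%SET \in ([set Some u; None] |: ([set None; Some v] |: lift_edges E))%SET.
  by rewrite !inE eqxx orbT.
have uv' : Some u != Some v by rewrite (inj_eq (@some_injective T)).
have hN' (e : {set option T}) : e \in ([set Some u; None] |: ([set None; Some v] |: lift_edges E))%SET ->
    None \in e -> e = [set None; Some u]%SET \/ e = [set None; Some v]%SET.
  move=> /setU1P[->|/setU1P[->|/NE /negPf ->]] // _; last by right.
  by left; rewrite finset.setUC.
have pS := planarE_suppress pj uv' p1 p2 hN'.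
apply: (planarE_map (@some_injective T) _ pS) => e /setU1P[->|eE].
  by rewrite finset.imsetU !finset.imset_set1 !inE eqxx.
have eL : (Some @: e)%SET \in lift_edges E by apply: imset_f.
have hN y : (Some @: e)%SET != [set None; y]%SET.
  by apply: contraNneq (NE _ eL) => ->; rewrite !inE eqxx.
by rewrite !in_setU1 !in_setD1 !hN !in_setU1 eL !orbT.
Qed.

Lemma card_lift_edges E : #|lift_edges E| = #|E|.
Proof. by apply: card_imset; apply: imset_inj; exact: some_injective. Qed.

Lemma planarE_joinable_pairs E : planarE R E -> exists (I : {set T}) (cl : T -> option T),
  [/\ forall i j, i \in I -> j \in I -> i != j -> planarE R ([set i; j]%SET |: E),
      forall u v, u != v -> cl u = cl v -> planarE R ([set u; v]%SET |: E) &
      (#|cl @: [set: T]%SET| + 5 * #|T| <= 5 * #|E| + 6 * #|I|)%N].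
Proof.
move=> pE; pose W : {set option T} := (Some @: [set: T]%SET)%SET.
have EW (e : {set option T}) : e \in lift_edges E -> e \subset W.
  by move=> /imsetP[f fE ->]; apply: imsetS; exact: finset.subsetT.
have NW : None \notin W by apply/negP => /imsetP[].
have [I [cl [IW hI hcl clW]]] := planarE_reducible (planarE_option pE) EW NW.
have cW : #|W| = #|T| by rewrite card_imset ?cardsT //; exact: some_injective.
rewrite -/(lift_edges E) card_lift_edges cW => card.
have SW (u : T) : Some u \in W by apply: imset_f; rewrite inE.
exists (Some @^-1: I)%SET, (cl \o Some); split.
- move=> i j; rewrite !inE => iI jI ij; apply: joinable_lift => //.
  by apply: hI => //; rewrite (inj_eq (@some_injective T)).
- move=> u w uw h; apply: joinable_lift => //.
  by apply: hcl; rewrite ?SW ?(inj_eq (@some_injective T)).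
- have -> : #|(Some @^-1: I)%SET| = #|I|.
    rewrite -(card_imset _ (@some_injective T)); apply: eq_card => y.
    apply/imsetP/idP => [[x]|yI]; first by rewrite inE => xI ->.
    by have /imsetP[x _ yx] := fintype.subsetP IW _ yI; exists x; rewrite ?inE -?yx.
  suff -> : ((cl \o Some) @: [set: T]%SET)%SET = (cl @: W)%SET by [].
  by rewrite /W -imset_comp.
Qed.

(** Every pair gives an edge that is either present or addable, and an edge arises from at most two
    ordered pairs. *)
Lemma leq_pairs_addable E (S : {set T * T}) : planarE R E ->
  (forall p, p \in S -> p.1 != p.2 /\ planarE R ([set p.1; p.2]%SET |: E)) ->
  (#|S| <= 2 * (#|addable E| + #|E|))%N.
Proof.
move=> pE hS; rewrite mulnC.
apply: (@leq_trans (#|addable E :|: E| * 2)); last first.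
  by rewrite leq_mul2r /= cardsU leq_subr.
apply: (@leq_card_fibers _ _ _ _ (fun p => [set p.1; p.2]%SET)) => [p /hS[p12 pp]|e _].
  rewrite finset.in_setU; case: (boolP (_ \in E)) => pE'; rewrite ?orbT // orbF.
  by apply/addableP; rewrite pE' cards2 p12.
case: (set_0Vmem [set p in S | [set p.1; p.2]%SET == e]%SET) => [->|[[u v]]]; first by rewrite cards0.
rewrite inE /= => /andP[uvS /eqP uve].
have [uv _] := hS _ uvS.
apply: (@leq_trans #|[set (u, v); (v, u)]%SET|); last by rewrite cards2; case: (_ != _).
apply/subset_leq_card/fintype.subsetP => -[y z]; rewrite !inE /= -uve => /andP[_ /eqP/esym].
by move=> /set2_eq/(_ uv)[[-> ->]|[-> ->]]; rewrite eqxx ?orbT.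
Qed.

(** With n_c the size of the class c, this is the sum of the inequalities 2 s n_c <= n_c^2 + s^2. *)
Lemma class_pairs (A B : finType) (cl : A -> B) (s : nat) :
  (2 * s * #|A| <= #|[set p : A * A | cl p.1 == cl p.2]%SET| + s ^ 2 * #|cl @: [set: A]%SET|)%N.
Proof.
pose n c := #|[set a | cl a == c]%SET|.
have img (F : A -> nat) :
    (\sum_a F a = \sum_(c in cl @: [set: A]%SET) \sum_(a | cl a == c) F a)%N.
  transitivity (\sum_(a in [set: A]%SET) F a)%N; first by apply: eq_bigl => a; rewrite inE.
  rewrite (partition_big_imset cl); apply: eq_bigr => c _.
  by apply: eq_bigl => a; rewrite inE.
have sumn : (#|A| = \sum_(c in cl @: [set: A]%SET) n c)%N.
  rewrite -sum1_card img; apply: eq_bigr => c _.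
  by rewrite /n -sum1_card; apply: eq_bigl => a; rewrite inE.
have sump : (#|[set p : A * A | cl p.1 == cl p.2]%SET| = \sum_(c in cl @: [set: A]%SET) n c * n c)%N.
  transitivity (\sum_a n (cl a))%N.
    rewrite -sum1dep_card.
    rewrite -(pair_big_dep xpredT (fun a b => cl a == cl b) (fun _ _ => 1%N)) /=.
    apply: eq_bigr => a _; rewrite /n -sum1_card; apply: eq_bigl => b.
    by rewrite inE eq_sym.
  rewrite img; apply: eq_bigr => c _.
  rewrite (eq_bigr (fun=> n c)) => [|a /eqP -> //].
  by rewrite sum_nat_const /n; congr muln; apply: eq_card => a; rewrite inE.
have -> : (2 * s * #|A| = \sum_(c in cl @: [set: A]%SET) 2 * s * n c)%N.
  by rewrite sumn big_distrr.
have -> : (s ^ 2 * #|cl @: [set: A]%SET| = \sum_(c in cl @: [set: A]%SET) s ^ 2)%N.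
  by rewrite sum_nat_const mulnC.
rewrite sump -big_split /=.
apply: leq_sum => c _; rewrite -mulnn; move: (n c) => m; clear.
by case/orP: (leq_total s m) => /subnKC <-; nia.
Qed.

(** In both cases about s |T| ordered pairs can be joined. Up to |T| of them are diagonal and up to
    2 |E| <= 4 |T| are already edges, hence s = 2 t + 5. If |I| <= |T| / (12 s), the excess of |E|
    and the term 6 |I| contribute at most |T| / (2 s) each, so there are at most |T| / s classes and
    [class_pairs] gives s |T| pairs. Otherwise |I| exceeds 12 s^2, since |T| is large, and the pairs
    within [I] number at least 12 s^2 |I| >= s |T|. *)
Lemma addable_lower E t : planarE R E ->
  let s := (2 * t + 5)%N in
  (12 * s * (12 * s ^ 2 + 1) <= #|T|)%N -> (10 * s * #|E| <= (10 * s + 1) * #|T|)%N ->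
  (t * #|T| <= #|addable E|)%N.
Proof.
move=> pE s nbig kn; have [I [cl [hI hcl card]]] := planarE_joinable_pairs pE.
have s5 : (5 <= s)%N by rewrite /s; clear; lia.
have sE : s = (2 * t + 5)%N by [].
clearbody s.
have k2 : (#|E| <= 2 * #|T|)%N.
  by move: kn s5; move: #|E| #|T| => k n; clear; nia.
have big : (s * #|T| <= 2 * (#|addable E| + #|E|) + #|T|)%N -> (t * #|T| <= #|addable E|)%N.
  rewrite sE; move: k2; move: #|E| #|T| #|addable E| => k n ad; clear; nia.
apply: big; have [Ismall|Ibig] := leqP (12 * s * #|I|) #|T|.
  pose S := [set p : T * T | (p.1 != p.2) && (cl p.1 == cl p.2)]%SET.
  have hS : (#|S| <= 2 * (#|addable E| + #|E|))%N.
    apply: leq_pairs_addable => // p; rewrite inE => /andP[p12 /eqP h].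
    by split => //; exact: hcl.
  have dS : (#|[set p : T * T | cl p.1 == cl p.2]%SET| <= #|S| + #|T|)%N.
    apply: (@leq_trans #|S :|: [set (a, a) | a : T]%SET|).
      apply/subset_leq_card/fintype.subsetP => -[u v]; rewrite !inE /= => h.
      case: (eqVneq u v) => [->|uv] /=; last by rewrite h.
      by apply/imsetP; exists v.
    rewrite cardsU; apply: leq_trans (leq_subr _ _) _.
    by rewrite leq_add2l leq_imset_card.
  have := class_pairs cl s; move: hS dS card Ismall kn s5.
  move: #|S| #|addable E| #|E| #|T| #|I| #|cl @: _| #|[set p : T * T | _]%SET|.
  move=> nS ad k n i nc np h1 h2 h3 h4 h5 h6 h7.
  have h8 : (s * nc <= n)%N by move: h3 h4 h5 h6; clear; nia.
  have h9 : (s ^ 2 * nc <= s * n)%N by rewrite -mulnA leq_mul2l h8 orbT.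
  move: h1 h2 h7 h9; move: (s ^ 2 * nc)%N => y; clear; lia.
pose S := [set p : T * T | [&& p.1 != p.2, p.1 \in I & p.2 \in I]]%SET.
have hS : (#|S| <= 2 * (#|addable E| + #|E|))%N.
  apply: leq_pairs_addable => // p; rewrite inE => /and3P[p12 h1 h2].
  by split => //; exact: hI.
have dS : (#|I| * #|I| <= #|S| + #|I|)%N.
  apply: (@leq_trans #|S :|: [set (a, a) | a in I]%SET|).
    rewrite -cardsX; apply/subset_leq_card/fintype.subsetP => -[u v]; rewrite !inE /= => /andP[uI vI].
    case: (eqVneq u v) => [->|uv] /=; last by rewrite uI vI.
    by apply/imsetP; exists v.
  rewrite cardsU; apply: leq_trans (leq_subr _ _) _.
  by rewrite leq_add2l leq_imset_card.
move: hS dS Ibig nbig s5.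
move: #|S| #|addable E| #|E| #|T| #|I| => nS ad k n i h1 h2 h3 h4 h5.
have h6 : (12 * s ^ 2 + 1 <= i)%N.
  have : (12 * s * (12 * s ^ 2 + 1) < 12 * s * i)%N by apply: leq_ltn_trans h4 h3.
  by rewrite ltn_pmul2l ?muln_gt0 /=; [exact: ltnW|move: h5; clear; lia].
have h7 : (12 * s ^ 2 * i + i <= i * i)%N.
  by rewrite -[X in (_ + X <= _)%N]mul1n -mulnDl leq_mul2r h6 orbT.
have h8 : (s * n <= 12 * s ^ 2 * i)%N.
  by rewrite (_ : (12 * s ^ 2 * i = s * (12 * s * i))%N); [rewrite leq_mul2l ltnW ?orbT|lia].
move: h1 h2 h7 h8; move: (12 * s ^ 2 * i)%N (s * n)%N (i * i)%N => y z w; clear; lia.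
Qed.

Lemma planar_sets_up k c : (forall E, E \in planar_sets k -> (c <= #|addable E|)%N) ->
  (#|planar_sets k| * c <= #|planar_sets k.+1| * k.+1)%N.
Proof.
move=> hc; apply: (@double_count _ _ _ _ (fun E F => E \subset F)) => [E Ek|F /planar_setsP[Fk pF]].
  have /planar_setsP[cE pE] := Ek.
  apply: leq_trans (hc _ Ek) _.
  rewrite -(@card_in_imset _ _ (fun e => e |: E)); last first.
    move=> e f /addableP[eE _ _] /addableP[fE _ _] h.
    have : e \in f |: E by rewrite -h !inE eqxx.
    by move=> /setU1P[//|eE']; rewrite eE' in eE.
  apply/subset_leq_card/fintype.subsetP => _ /imsetP[e /addableP[eE e2 pe] ->].
  rewrite inE finset.subsetUr andbT; apply/planar_setsP; split => //.
  by rewrite cardsU1 eE cE.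
apply: (@leq_trans #|[set F :\ e | e in F]%SET|); last by rewrite -Fk leq_imset_card.
apply/subset_leq_card/fintype.subsetP => E; rewrite inE => /andP[/planar_setsP[Ek pE] EF].
have : #|F :\: E| = 1%N by rewrite cardsD (finset.setIidPr EF) Fk Ek subSnn.
move=> /eqP/cards1P[e he]; apply/imsetP; exists e.
  by have : e \in F :\: E by [rewrite he inE]; rewrite inE => /andP[].
by rewrite -he finset.setDDr finset.setDv finset.set0U; apply/esym/finset.setIidPr.
Qed.

(** An added edge is given by a pair of vertices. Once k is linear in |T|, dividing by k + 1 leaves
    a ratio of order |T|. *)
Lemma planar_sets_down k :
  (#|planar_sets k.+1| * k.+1 <= #|planar_sets k| * (#|T| * #|T|))%N.
Proof.
apply: (@double_count _ _ _ _ (fun F E => E \subset F)) => [F /planar_setsP[Fk pF]|E /planar_setsP[Ek pE]].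
  rewrite -Fk -(@card_in_imset _ _ (fun e => F :\ e)); last first.
    move=> e f eF fF h; apply/eqP/negPn/negP => ef.
    have : e \in F :\ f by rewrite !inE ef.
    by rewrite -h !inE eqxx.
  apply/subset_leq_card/fintype.subsetP => _ /imsetP[e eF ->].
  rewrite inE finset.subsetDl andbT; apply/planar_setsP; split.
    by have := cardsD1 e F; rewrite eF Fk add1n => -[->].
  exact: planarE_sub pF (finset.subsetDl _ _).
rewrite -card_prod.
apply: (@leq_trans #|[set [set p.1; p.2]%SET |: E | p : T * T]%SET|); last exact: leq_imset_card.
apply/subset_leq_card/fintype.subsetP => F; rewrite inE => /andP[/planar_setsP[Fk pF] EF].
have : #|F :\: E| = 1%N by rewrite cardsD (finset.setIidPr EF) Fk Ek subSnn.
move=> /eqP/cards1P[e he].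
have eF : e \in F by have : e \in F :\: E by [rewrite he inE]; rewrite inE => /andP[].
have [u [v [_ euv]]] := planarE_simple pF eF.
apply/imsetP; exists (u, v) => //=; rewrite -euv -he finset.setUC.
by rewrite -[X in X :|: _](finset.setIidPr EF) finset.setID.
Qed.

End addable.

(** * Suppressing vertices of degree at most 2 *)

Section suppress_vertex.
Variables (R : realType) (T : finType).
Implicit Types (E F : {set {set T}}) (e f N : {set T}) (u v w : T).

Definition nbrs E v : {set T} := [set w | [set v; w]%SET \in E]%SET.

Definition drop_vertex E v : {set {set T}} := [set e in E | v \notin e]%SET.

(* The set of the two neighbours of [v] is itself the new edge. *)
Definition suppress E v : {set {set T}} :=
  if #|nbrs E v| == 2%N then nbrs E v |: drop_vertex E v else drop_vertex E v.

Definition star v N : {set {set T}} := [set [set v; w]%SET | w in N]%SET.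

Lemma nbrsN E v : planarE R E -> v \notin nbrs E v.
Proof.
by move=> pE; rewrite inE; apply/negP => /(planarE_neq pE); rewrite eqxx.
Qed.

Lemma star_drop E v : planarE R E -> E = star v (nbrs E v) :|: drop_vertex E v.
Proof.
move=> pE; apply/setP => e; rewrite finset.in_setU [e \in drop_vertex _ _]inE.
apply/idP/orP => [eE|[/imsetP[w]|/andP[]//]]; last by rewrite inE => ? ->.
case: (boolP (v \in e)) => ve; last by right; rewrite eE.
left; have [y [z [yz eyz]]] := planarE_simple pE eE.
move: ve; rewrite eyz !inE => /orP[]/eqP vE; apply/imsetP.
  by exists z; rewrite ?inE vE -?eyz.
by exists y; rewrite ?inE vE finset.setUC -?eyz.
Qed.

Lemma card_star v N : v \notin N -> #|star v N| = #|N|.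
Proof.
move=> vN; apply: card_in_imset => y z yN zN h.
have vy : v != y by apply: contraNneq vN => ->.
by case: (set2_eq h vy) => [[_ ->]//|[h' _]]; rewrite h' eqxx in vy.
Qed.

Lemma card_split E v : planarE R E -> #|E| = (#|nbrs E v| + #|drop_vertex E v|)%N.
Proof.
move=> pE; rewrite {1}(star_drop v pE) cardsU card_star ?nbrsN //.
rewrite (_ : _ :&: _ = finset.set0) ?cards0 ?subn0 //; apply/setP => e; rewrite !inE.
by apply/negP => /andP[/imsetP[w _ ->]]; rewrite !inE eqxx andbF.
Qed.

Lemma degree_nbrs E v : planarE R E -> degree E v = #|nbrs E v|.
Proof.
move=> pE; rewrite -(card_star (nbrsN v pE)); apply: eq_card => e; rewrite inE.
apply/andP/imsetP => [[eE ve]|[w]]; last by rewrite inE => ? ->; rewrite !inE eqxx.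
move: eE; rewrite {1}(star_drop v pE) !inE ve andbF orbF => /imsetP[w wN ->].
by exists w.
Qed.

Lemma nbrs_edge E v w : w \in nbrs E v -> [set v; w]%SET \in E.
Proof. by rewrite inE. Qed.

Lemma suppress_isolated E v : planarE R E -> isolated (suppress E v) v.
Proof.
move=> pE; apply/isolatedP => e; rewrite /suppress; case: ifP => _.
  by move=> /setU1P[->|]; [exact: nbrsN|rewrite inE => /andP[]].
by rewrite inE => /andP[].
Qed.

Lemma suppress_isolated_other E u v : isolated E u -> u != v -> isolated (suppress E v) u.
Proof.
move=> /isolatedP uE uv; apply/isolatedP => e.
have h : u \notin nbrs E v.
  by apply/negP; rewrite inE => /uE; rewrite !inE eqxx orbT.
rewrite /suppress; case: ifP => _.
  by move=> /setU1P[-> //|]; rewrite inE => /andP[/uE].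
by rewrite inE => /andP[/uE].
Qed.

Lemma drop_vertex_sub E v : drop_vertex E v \subset E.
Proof. by apply/fintype.subsetP => e; rewrite inE => /andP[]. Qed.

Lemma suppress_planar E v : planarE R E -> planarE R (suppress E v).
Proof.
move=> pE; have pD := planarE_sub pE (drop_vertex_sub E v).
rewrite /suppress; case: ifP => // /cards2P[a [b [ab Nab]]].
have aN : a \in nbrs E v by rewrite Nab !inE eqxx.
have bN : b \in nbrs E v by rewrite Nab !inE eqxx orbT.
have h : forall e, e \in E -> v \in e -> e = [set v; a]%SET \/ e = [set v; b]%SET.
  move=> e eE ve; move: eE; rewrite {1}(star_drop v pE) !inE ve andbF orbF => /imsetP[w].
  by rewrite Nab !inE => /orP[]/eqP -> ->; auto.
apply: planarE_subP (planarE_suppress pE ab (nbrs_edge aN) (nbrs_edge bN) h) _ => e.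
rewrite Nab => /setU1P[->|]; first by rewrite !inE eqxx.
rewrite inE => /andP[eE ve]; rewrite in_setU1 !in_setD1 eE.
have hv w : e != [set v; w]%SET by apply: contraNneq ve => ->; rewrite !inE eqxx.
by rewrite !hv orbT.
Qed.

(** Two neighbours cost one edge if they were not adjacent, and two if they were, because the new
    edge then exists already. *)
Lemma suppress_card E v : planarE R E -> (#|nbrs E v| <= 2)%N ->
  [\/ #|E| = #|suppress E v| /\ suppress E v = E,
      #|E| = #|suppress E v|.+1 | #|E| = #|suppress E v|.+2].
Proof.
move=> pE; have := card_split v pE; have := star_drop v pE; rewrite /suppress.
case cN : #|nbrs E v| => [|[|[|//]]] /= hE hc _.
- constructor 1; rewrite hc; split => //.
  by rewrite {2}hE (cards0_eq cN) /star finset.imset0 finset.set0U.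
- by constructor 2; rewrite hc.
- rewrite cardsU1; case: (_ \notin _); [constructor 2|constructor 3]; by rewrite hc.
Qed.

(** [A] contains the preimages in which [v] has one neighbour, [B] those with two adjacent
    neighbours, [C] those with two non-adjacent ones. In the last two cases the pair of neighbours
    is an edge of [E'], which makes the bound linear instead of quadratic. *)
Lemma suppress_fiber E' v :
  (#|[set E | [&& `[< planarE R E >], (#|nbrs E v| <= 2)%N, suppress E v == E' &
     #|E| != #|E'|]]%SET| <= #|T| + 2 * #|E'|)%N.
Proof.
pose A := [set [set v; w]%SET |: E' | w : T]%SET.
pose B := [set star v N :|: E' | N : {set T} in E']%SET.
pose C := [set star v N :|: (E' :\ N) | N : {set T} in E']%SET.
apply: (@leq_trans #|A :|: (B :|: C)|); last first.
  rewrite cardsU; apply: leq_trans (leq_subr _ _) _; apply: leq_add; first exact: leq_imset_card.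
  rewrite cardsU; apply: leq_trans (leq_subr _ _) _; rewrite mul2n -addnn.
  by apply: leq_add; exact: leq_imset_card.
apply/subset_leq_card/fintype.subsetP => E; rewrite inE => /and4P[/asboolP pE N2 /eqP hE' cE].
have hc := card_split v pE; have hE := star_drop v pE.
move: N2 hE' hc; rewrite /suppress; case cN : #|nbrs E v| => [|[|[|//]]] /= _ hE' hc.
- by move: cE; rewrite hc hE' eqxx.
- rewrite finset.in_setU; apply/orP; left; apply/imsetP.
  move/eqP/cards1P: cN => [w Nw]; exists w => //.
  by rewrite {1}hE Nw hE' /star finset.imset_set1.
- have NE : nbrs E v \in E' by rewrite -hE' !inE eqxx.
  rewrite !finset.in_setU; apply/orP; right.
  case: (boolP (nbrs E v \in drop_vertex E v)) => ND; apply/orP; [left|right].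
    apply/imsetP; exists (nbrs E v) => //.
    by rewrite {1}hE -hE'; congr (_ :|: _); apply/esym/finset.setUidPr; rewrite finset.sub1set.
  apply/imsetP; exists (nbrs E v) => //.
  by rewrite {1}hE -hE' setU1K.
Qed.

Lemma low_degree E : planarE R E ->
  (3 * #|T| <= 3 * #|[set v | (#|nbrs E v| <= 2)%N]%SET| + 2 * #|E|)%N.
Proof.
move=> pE.
have s1 : (\sum_(v in [set: T]%SET) degree E v = 2 * #|E|)%N.
  by apply: sum_degree => e; [move=> _; exact: finset.subsetT|exact: planarE_card2 pE].
have h : (\sum_(v in [set: T]%SET) 3 <=
    \sum_(v in [set: T]%SET) (3 * (#|nbrs E v| <= 2) + degree E v))%N.
  apply: leq_sum => v _; rewrite (degree_nbrs v pE); case: (leqP #|nbrs E v| 2) => h.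
    by rewrite muln1 leq_addr.
  exact: leq_trans h (leq_addl _ _).
have c1 : (\sum_(v in [set: T]%SET) (#|nbrs E v| <= 2)%N = #|[set v | (#|nbrs E v| <= 2)%N]%SET|)%N.
  rewrite -sum1dep_card [RHS]big_mkcond; apply: eq_big => [v|v _]; first by rewrite inE.
  by case: (_ <= _)%N.
have c3 : (\sum_(v in [set: T]%SET) 3 * (#|nbrs E v| <= 2) =
    3 * #|[set v | (#|nbrs E v| <= 2)%N]%SET|)%N by rewrite -c1 big_distrr.
by move: h; rewrite sum_nat_const cardsT mulnC big_split c3 s1.
Qed.

End suppress_vertex.

(** * Tree components *)

Lemma connect_agree (T : finType) (r r' : rel T) (x : T) :
  (forall y, connect r x y -> forall z, r y z = r' y z) -> connect r x =1 connect r' x.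
Proof.
move=> h y; apply/connectP/connectP => -[p].
- suff H a : connect r x a -> path r a p -> path r' a p.
    by move=> rp ->; exists p => //; apply: H rp; exact: connect0.
  elim: p a => //= b p IH a xa /andP[ab bp]; rewrite -h // ab /=.
  by apply: IH bp; apply: connect_trans xa (connect1 ab).
- suff H a : connect r x a -> path r' a p -> path r a p.
    by move=> rp ->; exists p => //; apply: H rp; exact: connect0.
  elim: p a => //= b p IH a xa /andP[]; rewrite -h // => ab bp; rewrite ab /=.
  by apply: IH bp; apply: connect_trans xa (connect1 ab).
Qed.

Section copies.
Variables (R : realType) (U : finType) (H : sgraph U) (T : finType).
Implicit Types (E F : {set {set T}}) (e f : {set T}) (u v w x y z : T) (C : {set T}) (g : U -> T).

Definition adjE E : rel T := fun x y => [set x; y]%SET \in E.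

Lemma adjE_sym E x y : adjE E x y = adjE E y x.
Proof. by rewrite /adjE finset.setUC. Qed.

Definition is_copy E C : Prop := exists (g : U -> T) (x : T),
  [/\ injective g, C = (g @: [set: U])%SET, C = [set y | connect (adjE E) x y]%SET &
      forall a b, adjE E (g a) (g b) = adj H a b].

(** Copies are recorded as vertex sets, so that automorphisms of [H] do not multiply the count. *)
Definition copies E : {set {set T}} := [set C : {set T} | `[< is_copy E C >]]%SET.

Lemma has_component_copy (G : sgraph T) C : C \in copies (edges G) -> has_component_iso G H.
Proof.
rewrite inE => /asboolP[g [x [gi Cg Cx ga]]]; exists x.
have ex (y : {y : T | y \in component G x}) : exists a, g a = val y.
  have : val y \in C by rewrite Cx; exact: (valP y).
  by rewrite Cg => /imsetP[a _ ->]; exists a.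
case: (choice ex) => f hf; have gC a : g a \in component G x.
  by have : g a \in C by [rewrite Cg imset_f]; rewrite Cx.
exists f.
  exists (fun a => exist _ (g a) (gC a)) => [y|a]; first by apply: val_inj; rewrite /= hf.
  by apply: gi; rewrite hf.
move=> y z; rewrite -ga !hf /adjE /adj inE.
by rewrite imsetU !imset_set1.
Qed.

Lemma copies_agree E F C x : C = [set y | connect (adjE F) x y]%SET ->
  (forall y z, y \in C -> adjE F y z = adjE E y z) -> C \in copies F -> C \in copies E.
Proof.
move=> Cx FE; rewrite [C \in copies F]inE => /asboolP[g [x' [gi Cg Cx' ga]]].
rewrite inE; apply/asboolP.
exists g, x; split => //.
- apply/setP => y; rewrite Cx !inE; apply: connect_agree => z xz t.
  by apply: FE; rewrite Cx inE.
- by move=> a b; rewrite -ga FE // Cg imset_f.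
Qed.

Lemma copies_comp E C : C \in copies E -> exists x, C = [set y | connect (adjE E) x y]%SET.
Proof. by rewrite inE => /asboolP[g [x [_ _ h _]]]; exists x. Qed.

Lemma connectE_sym E : connect_sym (adjE E).
Proof. by apply: sym_connect_sym => x y; exact: adjE_sym. Qed.

(** A new copy contains [v] or a neighbour of [v]. Two neighbours are joined by the new edge and so
    lie in one component, hence a single [w] represents them; without neighbours [w] defaults to
    [v]. *)
Lemma copies_suppress E v : planarE R E -> (#|nbrs E v| <= 2)%N ->
  (#|copies (suppress E v)| <= #|copies E| + 2)%N.
Proof.
move=> pE N2; set F := suppress E v.
pose w := odflt v [pick w in nbrs E v].
pose cF x := [set y | connect (adjE F) x y]%SET.
suff s : copies F \subset copies E :|: [set cF v; cF w]%SET.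
  apply: leq_trans (subset_leq_card s) _; rewrite cardsU; apply: leq_trans (leq_subr _ _) _.
  by rewrite leq_add2l cards2; case: (_ != _).
apply/fintype.subsetP => C CF; rewrite !finset.in_setU !finset.in_set1; apply/or3P.
have [x Cx] := copies_comp CF.
have cE y : y \in C -> C = cF y.
  rewrite Cx inE => xy; apply/setP => z; rewrite /cF !inE.
  by rewrite (same_connect (connectE_sym F) xy).
case: (boolP (v \in C)) => vC; first by constructor 2; apply/eqP; exact: cE.
case: (boolP (w \in C)) => wC; first by constructor 3; apply/eqP; exact: cE.
have closed a b : a \in C -> adjE F a b -> b \in C.
  by rewrite Cx !inE => xa ab; apply: connect_trans xa (connect1 ab).
have wN y' : y' \in nbrs E v -> w \in nbrs E v.
  by rewrite /w; case: pickP => //= h; rewrite h.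
constructor 1; apply: (copies_agree Cx _ CF) => y z yC.
have yN : y \notin nbrs E v.
  apply/negP => yN; have wN' := wN _ yN.
  have [yw|yw] := eqVneq y w; first by rewrite yw in yC; rewrite yC in wC.
  have sub : [set y; w]%SET \subset nbrs E v.
    by rewrite finset.subUset !finset.sub1set yN wN'.
  have c2 : #|[set y; w]%SET| = 2%N by rewrite cards2 yw.
  have N2' : #|nbrs E v| == 2%N by rewrite eqn_leq N2 -c2 subset_leq_card.
  have NE : [set y; w]%SET = nbrs E v.
    by apply/eqP; rewrite eqEcard sub c2 (eqP N2').
  case/negP: wC; apply: closed yC _; rewrite /adjE NE /F /suppress N2'.
  by rewrite !inE eqxx.
have yv : v != y by apply: contraNneq vC => ->.
have DF e : e \in drop_vertex E v -> e \in F.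
  by move=> eD; rewrite /F /suppress; case: ifP => // _; rewrite in_setU1 eD orbT.
rewrite /adjE; apply/idP/idP => [|h].
  rewrite /F /suppress; case: ifP => _; last by rewrite inE => /andP[].
  move=> /setU1P[h|]; last by rewrite inE => /andP[].
  by case/negP: yN; rewrite -h !inE eqxx.
apply: DF; rewrite inE h !inE negb_or yv /=.
by apply: contraNneq yN => vz; rewrite inE finset.setUC vz.
Qed.

Section plant.
Variable g : U -> T.
Hypothesis gi : injective g.

Definition plant (D : {set {set U}}) : {set {set T}} := [set (g @: e)%SET | e : {set U} in D]%SET.

Lemma copies_plant E : (forall a, isolated E (g a)) -> connected_graph H ->
  (g @: [set: U])%SET \in copies (E :|: plant (edges H)) /\
  (#|copies (E :|: plant (edges H))| <= #|copies E| + 1)%N.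
Proof.
move=> iso [/card_gt0P[a0 _] Hc]; set F := E :|: _; set S := (g @: _)%SET.
have gS a : g a \in S by apply: imset_f; rewrite inE.
have adjg a b : adjE F (g a) (g b) = adj H a b.
  have e2 : (g @: [set a; b] = [set g a; g b])%SET by rewrite imsetU !imset_set1.
  rewrite /adjE /adj /F -e2 finset.in_setU mem_imset; last exact: imset_inj.
  case: (boolP (_ \in E)) => // /(isolatedP _ _ (iso a)).
  by rewrite imset_f // !inE eqxx.
have Fout a y : adjE F (g a) y -> y \in S.
  rewrite /adjE /F finset.in_setU => /orP[/(isolatedP _ _ (iso a))|/imsetP[e _ h]].
    by rewrite !inE eqxx.
  have : y \in (g @: e)%SET by rewrite -h !inE eqxx orbT.
  by move=> /imsetP[b _ ->].
have SP y : y \in S -> exists a, y = g a by move=> /imsetP[a _ ->]; exists a.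
have compS a : S = [set y | connect (adjE F) (g a) y]%SET.
  apply/setP => y; rewrite inE; apply/idP/idP => [/SP[b ->]|/connectP[p]].
    have /connectP[p hp ->] := Hc a b; elim: p a hp => [|c p IH] a /=; first by rewrite connect0.
    move=> /andP[ac cp]; apply: connect_trans (IH _ cp).
    by apply: connect1; rewrite adjg.
  elim: p a => [|z p IH] a /= => [_ -> //|/andP[az zp] yE].
  by have [c zc] := SP _ (Fout _ _ az); subst z; apply: IH zp yE.
have SF : S \in copies F.
  rewrite inE; apply/asboolP; exists g, (g a0); split => //; exact: compS.
split => //; suff s : copies F \subset copies E :|: [set S]%SET.
  apply: leq_trans (subset_leq_card s) _; rewrite cardsU; apply: leq_trans (leq_subr _ _) _.
  by rewrite cards1.
apply/fintype.subsetP => C CF; rewrite finset.in_setU finset.in_set1.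
have [x Cx] := copies_comp CF.
case: (boolP (x \in S)) => [/SP[a xa]|xS].
  by rewrite Cx xa -compS eqxx orbT.
apply/orP; left; apply: (copies_agree Cx _ CF) => y z yC.
have yS : y \notin S.
  apply: contraNN xS => /SP[a ya]; rewrite (compS a) inE (connectE_sym F) -ya.
  by move: yC; rewrite Cx inE.
rewrite /adjE /F finset.in_setU orb_idr // => /imsetP[e _ h].
case/negP: yS; have : y \in (g @: e)%SET by rewrite -h !inE eqxx.
by move=> /imsetP[a _ ->].
Qed.

Lemma card_plant E (D : {set {set U}}) : (forall a, isolated E (g a)) -> (forall e : {set U}, e \in D -> #|e| = 2%N) ->
  #|E :|: plant D| = (#|E| + #|D|)%N.
Proof.
move=> iso D2; rewrite cardsU (card_imset _ (imset_inj gi)).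
rewrite (_ : _ :&: _ = finset.set0) ?cards0 ?subn0 //; apply/setP => f; rewrite !inE.
apply/negP => /andP[fE /imsetP[e eD fe]].
have /card_gt0P[a ae] : (0 < #|e|)%N by rewrite D2.
by have := isolatedP _ _ (iso a) _ fE; rewrite fe imset_f.
Qed.

End plant.

(** Given the position of the planted copy, the original edge set is recovered. *)
Lemma plant_fiber (g : U -> T) E : (forall a, isolated E (g a)) ->
  (forall e : {set U}, e \in edges H -> #|e| = 2%N) ->
  E = [set e in E :|: plant g (edges H) | [forall a, g a \notin e]]%SET.
Proof.
move=> iso D2; apply/setP => f; rewrite !inE; apply/idP/andP => [fE|[/orP[//|]]].
  by split; [rewrite fE|apply/forallP => a; exact: isolatedP _ _ (iso a) _ fE].
move=> /imsetP[e eD ->] /forallP h.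
have /card_gt0P[a ae] : (0 < #|e|)%N by rewrite D2.
by have := h a; rewrite imset_f.
Qed.

End copies.

(** * Forests: leaves, number of edges, planting *)

Section forests.
Variables (R : realType) (U : finType) (H : sgraph U).
Hypothesis Ha : acyclic H.
Implicit Types (D : {set {set U}}) (a b c : U).

Lemma edges2 (e : {set U}) : e \in edges H -> #|e| = 2%N.
Proof. by move=> eH; have /forall_inP/(_ _ eH)/eqP := edges_card2 H. Qed.

Lemma edges_neq a b : [set a; b]%SET \in edges H -> a != b.
Proof. by move/edges2; rewrite cards2; case: (a != b). Qed.

(** Without a leaf, any path can be extended at its head by a second edge there. The new vertex
    either closes a cycle or is new to the path, and the latter cannot happen more than |U|
    times. *)
Lemma forest_leaf D : D \subset edges H -> D != finset.set0 ->
  exists a b, [set a; b]%SET \in D /\ forall e, e \in D -> a \in e -> e = [set a; b]%SET.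
Proof.
move=> DH D0; apply: contrapT => nleaf.
have e2 e : e \in D -> exists a b, a != b /\ e = [set a; b]%SET.
  move=> /(fintype.subsetP DH)/edges2 /eqP/cards2P[a [b [ab ->]]].
  by exists a, b.
have next a b : [set a; b]%SET \in D -> exists2 c, c != b & [set a; c]%SET \in D.
  move=> abD; apply: contrapT => nc; apply: nleaf; exists a, b; split => // e eD ae.
  have [y [z [yz eyz]]] := e2 _ eD.
  have [c ec] : exists c, e = [set a; c]%SET.
    move: ae; rewrite eyz !inE => /orP[]/eqP ->; first by exists z.
    by exists y; rewrite finset.setUC.
  rewrite ec; have [-> //|cb] := eqVneq c b.
  by case: nc; exists c; rewrite // -ec.
have long n : exists a b p, [/\ uniq [:: a, b & p],
    path (fun x y => [set x; y]%SET \in D) a (b :: p) & size p = n].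
  elim: n => [|n [a [b [p [up pp sp]]]]].
    have [e eD] := set0Pn _ D0; have [a [b [ab eab]]] := e2 _ eD.
    by exists a, b, [::]; rewrite /= inE ab -eab eD.
  move: (pp) => /= /andP[abD bp].
  have [c cb acD] := next _ _ abD.
  have ac : a != c by apply: edges_neq; exact: fintype.subsetP DH _ acD.
  have pc : path (fun x y => [set x; y]%SET \in D) c [:: a, b & p].
    by rewrite /= finset.setUC acD abD bp.
  case: (boolP (c \in p)) => cp; last first.
    exists c, a, (b :: p); split => //; last by rewrite /= sp.
    apply/andP; split; last exact: up.
    by rewrite !inE !negb_or eq_sym ac cb.
  (* The new neighbour [c] of [a] already lies on the path beyond [b], which closes the cycle
     [a, b, p1, c] of at least three vertices. *)
  exfalso; case/splitPr: cp up pp {pc sp bp} => p1 p2 up pp.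
  apply: (Ha (p := a :: b :: rcons p1 c)); first by rewrite /= size_rcons.
  apply/andP; split; last first.
    by move: up; rewrite -cat_rcons -!cat_cons cat_uniq => /andP[].
  rewrite /cycle rcons_path last_cons last_rcons; apply/andP; split; last first.
    by rewrite /adj finset.setUC; exact: fintype.subsetP DH _ acD.
  move: pp; rewrite -cat_rcons -cat_cons cat_path => /andP[+ _].
  by apply: sub_path => y z; exact: fintype.subsetP.
have [a [b [p [up _ sp]]]] := long #|U|.
have := max_card (mem [:: a, b & p]); rewrite (card_uniqP up) /= sp leqNgt.
by rewrite ltnS leqnSn.
Qed.

Lemma forest_ind (P : {set {set U}} -> Prop) : P finset.set0 ->
  (forall D a b, [set a; b]%SET |: D \subset edges H -> isolated D a -> P D ->
     P ([set a; b]%SET |: D)) -> P (edges H).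
Proof.
move=> P0 PS; suff h n D : D \subset edges H -> #|D| = n -> P D by exact: h.
elim: n D => [|n IH] D DH cD; first by rewrite (cards0_eq cD).
have [|a [b [abD ha]]] := forest_leaf DH; first by rewrite -card_gt0 cD.
have DE := finset.setD1K abD; rewrite -DE; apply: PS; first by rewrite DE.
  by apply/isolatedP => e /setD1P[ne eD]; apply: contraNN ne => /(ha _ eD) ->.
apply: IH; first exact: fintype.subset_trans (finset.subsetDl _ _) DH.
by have := cardsD1 [set a; b]%SET D; rewrite abD cD => -[].
Qed.

Lemma forest_edges_lt : (0 < #|U|)%N -> (#|edges H| < #|U|)%N.
Proof.
(* Counting covered vertices makes the induction work, since every added edge covers a new one; the
   edgeless case, with 0 of both, is set apart. *)
move=> U0; suff : (#|edges H| = 0 \/ #|edges H| < #|finset.cover (edges H)|)%N.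
  by move=> [-> //|h]; apply: leq_trans h (max_card _).
apply: (@forest_ind (fun D => (#|D| = 0 \/ #|D| < #|finset.cover D|)%N)); first by left; rewrite cards0.
move=> D a b DH aD IH; right.
have ab : a != b by apply: edges_neq; apply: (fintype.subsetP DH); rewrite !inE eqxx.
have s : a |: (b |: finset.cover D) \subset finset.cover ([set a; b]%SET |: D).
  apply/fintype.subsetP => y; rewrite !in_setU1 => /or3P[/eqP->|/eqP->|].
  - by apply/finset.bigcupP; exists [set a; b]%SET; rewrite !inE eqxx.
  - by apply/finset.bigcupP; exists [set a; b]%SET; rewrite !inE eqxx ?orbT.
  - move=> /finset.bigcupP[e eD ye]; apply/finset.bigcupP; exists e => //.
    by rewrite in_setU1 eD orbT.
have aN : a \notin b |: finset.cover D.
  rewrite in_setU1 negb_or ab; apply/finset.bigcupP => -[e eD ae].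
  by move/isolatedP: aD => /(_ _ eD); rewrite ae.
apply: leq_trans (subset_leq_card s); rewrite cardsU1 aN /= add1n ltnS.
case: IH => [D0|h].
  rewrite (cards0_eq D0) finset.setU0 cards1; apply/card_gt0P; exists b.
  by rewrite !inE eqxx.
apply: leq_trans (subset_leq_card (finset.subsetUr [set b]%SET (finset.cover D))).
by rewrite cardsU1; case: (_ \notin _); lia.
Qed.

(** [forest_ind] adds the edges in an order in which one end is still isolated, so every step is a
    pendant edge. *)
Lemma planarE_plant (T : finType) (g : U -> T) (E : {set {set T}}) : injective g ->
  planarE R E -> (forall a, isolated E (g a)) -> planarE R (E :|: plant g (edges H)).
Proof.
move=> gi pE iso; apply: (@forest_ind (fun D => planarE R (E :|: plant g D))).
  by rewrite /plant finset.imset0 finset.setU0.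
move=> D a b DH aD pD; have ab : a != b.
  by apply: edges_neq; apply: (fintype.subsetP DH); rewrite !inE eqxx.
have gaI : isolated (E :|: plant g D) (g a).
  apply/isolatedP => f; rewrite finset.in_setU => /orP[|/imsetP[e eD ->]].
    exact: (isolatedP _ _ (iso a)).
  by rewrite mem_imset //; exact: (isolatedP _ _ aD).
apply: planarE_subP (planarE_pendant pD gaI (w := g b) _) _; first by rewrite (inj_eq gi).
move=> f; rewrite !finset.in_setU => /orP[->|/imsetP[e /setU1P[->|eD] ->]]; rewrite ?orbT //.
  by rewrite finset.imsetU !finset.imset_set1 finset.in_set1 eqxx.
by rewrite (imset_f (fun e : {set U} => g @: e)%SET eD) !orbT.
Qed.

End forests.

(** * The switching *)

Section counting.
Variables (R : realType) (U : finType) (H : sgraph U) (T : finType).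
Implicit Types (E F : {set {set T}}) (j k l : nat).

(* The bound on the number of copies makes planting [H] on [x.1] boundedly many-to-one. *)
Definition states j k : {set j.-tuple T * {set {set T}}} :=
  [set x : j.-tuple T * {set {set T}} | [&& uniq x.1, all (isolated x.2) x.1,
     x.2 \in planar_sets R T k & (#|copies H x.2| <= 2 * j)%N]]%SET.

Lemma statesP j k (x : j.-tuple T * {set {set T}}) :
  reflect [/\ uniq x.1, (forall v, v \in x.1 -> isolated x.2 v), #|x.2| = k, planarE R x.2 &
           (#|copies H x.2| <= 2 * j)%N] (x \in states j k).
Proof.
rewrite inE; apply: (iffP and4P) => [[h1 /allP h2 /planar_setsP[h3 h4] h5]|[h1 h2 h3 h4 h5]] //.
by split => //; [exact/allP|exact/planar_setsP].
Qed.

(** Choices of the next vertex to isolate, sorted by the number [l] of edges lost, because the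
    fibres of [move_to] are of different orders for l = 0 and l > 0. *)
Definition moves j k l : {set (j.-tuple T * {set {set T}}) * T} :=
  [set p : (j.-tuple T * {set {set T}}) * T | [&& p.1 \in states j k, p.2 \notin p.1.1,
     (#|nbrs p.1.2 p.2| <= 2)%N & #|p.1.2| == (#|suppress p.1.2 p.2| + l)%N]]%SET.

Lemma movesP j k l (p : (j.-tuple T * {set {set T}}) * T) :
  reflect [/\ p.1 \in states j k, p.2 \notin p.1.1, (#|nbrs p.1.2 p.2| <= 2)%N &
     #|p.1.2| = (#|suppress p.1.2 p.2| + l)%N] (p \in moves j k l).
Proof.
apply: (iffP idP) => [|[h1 h2 h3 h4]]; first by rewrite finset.in_set => /and4P[? ? ? /eqP].
by rewrite finset.in_set h1 h2 h3 h4 eqxx.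
Qed.

Definition move_to j (p : (j.-tuple T * {set {set T}}) * T) :
    j.+1.-tuple T * {set {set T}} :=
  ([tuple of p.2 :: p.1.1], suppress p.1.2 p.2).

Lemma move_to_states j k l p : p \in moves j k l -> move_to p \in states j.+1 (k - l).
Proof.
case: p => [[s E] v] /movesP[/statesP[/= us sE Ek pE cE] vs N2 lE]; apply/statesP => /=; split.
- by rewrite vs us.
- move=> u; rewrite inE => /predU1P[->|us']; first exact: suppress_isolated pE.
  apply: suppress_isolated_other; first exact: sE.
  by apply: contraNneq vs => <-.
- by rewrite -Ek lE addnK.
- exact: suppress_planar.
- apply: leq_trans (copies_suppress H pE N2) _; move: cE; move: #|_| => x; clear; lia.
Qed.

Lemma move_to_inj j (p q : (j.-tuple T * {set {set T}}) * T) :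
  move_to p = move_to q -> p.1.2 = q.1.2 -> p = q.
Proof.
case: p q => [[s E] v] [[s' E'] v'] /= [] vE sE _ EE.
by congr (_, _, _) => //; apply: val_inj.
Qed.

Lemma card_moves j k l (d : nat) : (forall (v : T) E', (#|E'| = k - l)%N ->
    (#|[set E : {set {set T}} | [&& `[< planarE R E >], (#|nbrs E v| <= 2)%N, suppress E v == E' &
      #|E| == #|E'| + l]]%SET| <= d)%N) ->
  (#|moves j k l| <= #|states j.+1 (k - l)| * d)%N.
Proof.
move=> hd; apply: (@leq_card_fibers _ _ _ _ (@move_to j)) => [p|[s E'] /statesP[_ _ /= cE' _ _]].
  exact: move_to_states.
apply: leq_trans (hd (thead s) E' cE').
rewrite -(@card_in_imset _ _ (fun p => p.1.2)); last first.
  move=> p q; rewrite inE [q \in _]inE => /andP[_ /eqP hp] /andP[_ /eqP hq].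
  by apply: move_to_inj; rewrite hp hq.
apply/subset_leq_card/fintype.subsetP => y /imsetP[p].
rewrite inE => /andP[/movesP[/statesP[_ _ _ pE _] _ N2 lE] /eqP[hs hE] ->].
have -> : thead s = p.2 by rewrite -hs theadE.
by rewrite inE -hE N2 eqxx lE eqxx !andbT; exact/asboolP.
Qed.

(** At most [j] of the low-degree vertices are already in the tuple, so each state has at least [d]
    moves. The tuple records the suppressed vertex: a move without loss can be undone uniquely, and
    one that loses one or two edges in at most |T| + 2 k ways by [suppress_fiber]. *)
Lemma states_step j k d :
  (forall E, E \in planar_sets R T k -> (d + j <= #|[set v | (#|nbrs E v| <= 2)%N]%SET|)%N) ->
  (#|states j k| * d <= #|states j.+1 k| +
     (#|states j.+1 (k - 1)| + #|states j.+1 (k - 2)|) * (#|T| + 2 * k))%N.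
Proof.
move=> hd; pose S := moves j k 0 :|: (moves j k 1 :|: moves j k 2).
have m0 : (#|moves j k 0| <= #|states j.+1 k| * 1)%N.
  have := @card_moves j k 0 1; rewrite subn0; apply => v E' _.
  apply: leq_trans (_ : (#|[set E']%SET| <= 1)%N); last by rewrite cards1.
  apply/subset_leq_card/fintype.subsetP => E.
  rewrite inE addn0 => /and4P[/asboolP pE N2 /eqP hE /eqP cE]; apply/set1P.
  case: (suppress_card pE N2) => [[_ <-]//|h|h]; move: h; rewrite hE cE.
    by move/eqP; rewrite -[X in X == _]addn0 -addn1 eqn_add2l.
  by move/eqP; rewrite -[X in X == _]addn0 -addn2 eqn_add2l.
have m12 l : (0 < l)%N -> (#|moves j k l| <= #|states j.+1 (k - l)| * (#|T| + 2 * k))%N.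
  move=> l0; apply: card_moves => v E' cE'.
  apply: leq_trans (_ : (#|T| + 2 * #|E'| <= _)%N); last first.
    by rewrite leq_add2l leq_mul2l cE' leq_subr.
  apply: leq_trans (suppress_fiber R E' v).
  apply/subset_leq_card/fintype.subsetP => E; rewrite !inE => /and4P[-> -> -> /eqP ->] /=.
  by rewrite -[X in _ != X]addn0 eqn_add2l -lt0n.
have SQ : (#|states j k| * d <= #|S| * 1)%N.
  apply: (@double_count _ _ _ _ (fun x p => p.1 == x)) => [x xQ|p _].
    have /statesP[us sE Ek pE cE] := xQ.
    have xP : x.2 \in planar_sets R T k by apply/planar_setsP.
    pose L := [set v | (#|nbrs x.2 v| <= 2)%N]%SET.
    have hL : (d <= #|L :\: [set v in x.1]%SET|)%N.
      rewrite cardsD; apply: leq_trans (_ : (#|L| - j <= _)%N).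
        by rewrite leq_subRL ?(leq_trans (leq_addl _ _) (hd _ xP)) // addnC; exact: hd.
      apply: leq_sub2l; apply: leq_trans (subset_leq_card (finset.subsetIr _ _)) _.
      rewrite cardsE; apply: leq_trans (card_size _) _; by rewrite size_tuple.
    apply: leq_trans hL _.
    rewrite -(@card_in_imset _ _ (fun v => (x, v))); last by move=> v w _ _ [].
    apply/subset_leq_card/fintype.subsetP => _ /imsetP[v vL ->].
    have [vx N2] : v \notin val x.1 /\ (#|nbrs x.2 v| <= 2)%N.
      by move: vL; rewrite !inE => /andP[].
    apply/setIdP; split; last exact: eqxx.
    rewrite /S !finset.in_setU.
    have hS l : #|x.2| = (#|suppress x.2 v| + l)%N -> (x, v) \in moves j k l.
      by move=> h; apply/movesP.
    case: (suppress_card pE N2) => [[h _]|h|h].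
    - by rewrite (hS 0%N) // addn0.
    - by rewrite (hS 1%N) ?orbT // addn1.
    - by rewrite (hS 2%N) ?orbT // addn2.
  apply: leq_trans (_ : (#|[set p.1]%SET| <= 1)%N); last by rewrite cards1.
  apply/subset_leq_card/fintype.subsetP => x.
  by rewrite !inE => /andP[_ /eqP ->].
apply: leq_trans SQ _; rewrite muln1 /S cardsU; apply: leq_trans (leq_subr _ _) _.
apply: leq_add; first by rewrite -[X in (_ <= X)%N]muln1.
rewrite cardsU; apply: leq_trans (leq_subr _ _) _; rewrite mulnDl.
by apply: leq_add; exact: m12.
Qed.

(** To undo a planting, choose which copy was planted and how its vertices are labelled by [U], in
    at most |U| ^ |U| ways. This fixes the tuple, and [plant_fiber] then fixes the edge set. *)
Lemma states_plant k : is_tree H ->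
  (#|states #|U| k| <= #|planar_sets R T (k + #|edges H|)| * ((2 * #|U| + 1) * #|U| ^ #|U|))%N.
Proof.
move=> [Hc Ha]; pose g (s : #|U|.-tuple T) (a : U) := tnth s (enum_rank a).
have gi (s : #|U|.-tuple T) : uniq s -> injective (g s).
  by move=> us a b /(tuple_uniqP _ us) /enum_rank_inj.
have iso x : x \in states #|U| k -> forall a, isolated x.2 (g x.1 a).
  by move=> /statesP[_ h _ _ _] a; apply: h; exact: mem_tnth.
pose f (x : #|U|.-tuple T * {set {set T}}) := x.2 :|: plant (g x.1) (edges H).
have e2 := @edges2 _ H.
apply: (@leq_card_fibers _ _ _ _ f) => [x xS|E2 _].
  have xI := iso _ xS; have /statesP[us sE Ek pE cE] := xS.
  apply/planar_setsP; split; first by rewrite card_plant ?Ek //; exact: gi.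
  by apply: planarE_plant => //; exact: gi.
case: (set_0Vmem [set x in states #|U| k | f x == E2]%SET) => [->|[x0]].
  by rewrite cards0.
rewrite inE => /andP[x0S /eqP fx0].
(* One preimage [x0] suffices to bound the copies in [E2]: it has at most 2 |U| of them, and
   planting adds at most one. *)
have cE2 : (#|copies H E2| <= 2 * #|U| + 1)%N.
  have xI := iso _ x0S; have /statesP[us sE Ek pE cE] := x0S.
  have [_ h] := copies_plant (gi _ us) xI Hc; rewrite -/(f x0) fx0 in h.
  by apply: leq_trans h _; rewrite leq_add2r.
apply: leq_trans (_ : (#|copies H E2| * #|U| ^ #|U| <= _)%N); last by rewrite leq_mul2r cE2 orbT.
apply: (@leq_card_fibers _ _ _ _ (fun x => (g x.1 @: [set: U])%SET)) => [x|C].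
  rewrite inE => /andP[xS /eqP fx]; have xI := iso _ xS; have /statesP[us sE Ek pE cE] := xS.
  by have [h _] := copies_plant (gi _ us) xI Hc; rewrite -fx.
rewrite [C \in _]inE => /asboolP[g0 [_ [g0i Cg0 _ _]]].
have cC : #|C| = #|U| by rewrite Cg0 card_imset // cardsT.
have -> : (#|U| ^ #|U| = #|C| ^ #|U|)%N by rewrite cC.
rewrite -card_ffun_on.
rewrite -(@card_in_imset _ _ (fun x => [ffun a => g x.1 a])); last first.
  move=> [s E] [s' E'] /setIdP[/setIdP[xS /eqP fx] _] /setIdP[/setIdP[yS /eqP fy] _] /ffunP h.
  have ss : s = s'.
    apply: eq_from_tnth => i; have := h (enum_val i); rewrite !ffunE /g /=.
    by rewrite enum_valK.
  congr pair => //.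
  have /= EE := plant_fiber (iso _ xS) (@e2); have /= EE' := plant_fiber (iso _ yS) (@e2).
  have eqs : E :|: plant (g s) (edges H) = E' :|: plant (g s') (edges H) := etrans fx (esym fy).
  by rewrite [LHS]EE [RHS]EE' eqs ss.
apply/subset_leq_card/fintype.subsetP => y /imsetP[x]; rewrite inE => /andP[_ /eqP hC] ->.
by apply/ffun_onP => a; rewrite ffunE -hC imset_f.
Qed.

End counting.

(** The three terms contribute at most n X + 4 n X + 4 n X = 9 n X, and d >= n / 10 turns the factor
    9 into 90. *)
Lemma recursion_bound (n d w s s0 s1 s2 t X : nat) : (0 < n)%N -> (n <= 10 * d)%N -> (w <= 4 * n)%N ->
  (s * d <= s0 + (s1 + s2) * w)%N -> (s0 * t <= n * X)%N -> (s1 * t <= X)%N ->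
  (s2 * t <= X)%N -> (s * t <= 90 * X)%N.
Proof.
move=> n0 nd wn sd h0 h1 h2; rewrite -(leq_pmul2l n0).
apply: (@leq_trans (10 * (s * d * t))).
  by rewrite mulnCA [X in (X <= _)%N]mulnC !mulnA [X in (_ <= X)%N]mulnAC; nia.
apply: (@leq_trans (10 * ((s0 + (s1 + s2) * (4 * n)) * t))).
  rewrite leq_mul2l /= leq_mul2r; apply/orP; right; apply: leq_trans sd _.
  by rewrite leq_add2l leq_mul2l wn orbT.
nia.
Qed.

(** * Solving the recursion of the switching *)

Section bound.
Variables (R : realType) (U : finType) (H : sgraph U) (T : finType).
Implicit Types (E F : {set {set T}}) (i j k l : nat).

Let a k := #|planar_sets R T k|.
Let h := #|U|.
Let n := #|T|.

Lemma states_bound (t D m : nat) : is_tree H -> (0 < t <= n)%N -> (0 < D)%N ->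
  (20 * h + 8 <= n)%N -> (2 * h <= m)%N -> (8 * m <= 9 * n)%N ->
  (forall k, (k < m)%N -> (a k * t <= a k.+1)%N) ->
  (forall k, (m <= k)%N -> (a k.+1 <= a k * (D * n))%N) ->
  (#|states R H T 0 m| * t <= 90 ^ h * ((2 * h + 1) * h ^ h * D ^ h) * a m)%N.
Proof.
move=> Ht /andP[t0 tn] D0 nbig mh mn up down.
have n0 : (0 < n)%N := leq_trans t0 tn.
have eh : (#|edges H| < h)%N by apply: forest_edges_lt; case: Ht => -[].
set e := #|edges H| in eh.
(* However many edges are missing, only a single factor [t] is kept. *)
have up1 d : (d < m)%N -> (a (m - d.+1) * t <= a m)%N.
  elim: d => [|d IH] dm; first by have := up (m - 1)%N; rewrite subn1 (ltn_predK dm); apply.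
  apply: leq_trans (IH (ltnW dm)); rewrite leq_mul2r; apply/orP; right.
  have -> : (m - d.+1 = (m - d.+2).+1)%N by rewrite subnSK.
  apply: leq_trans (up _ _); last by rewrite ltn_subrL /= (leq_trans _ dm).
  by rewrite -{1}[a _]muln1 leq_mul2l t0 orbT.
have down1 d : (a (m + d) <= a m * (D * n) ^ d)%N.
  elim: d => [|d IH]; first by rewrite addn0 muln1.
  rewrite addnS; apply: leq_trans (down _ (leq_addr _ _)) _.
  by rewrite expnSr [X in (_ <= X)%N]mulnA leq_mul2r IH orbT.
pose K := ((2 * h + 1) * h ^ h * D ^ h)%N.
(* Here [j] vertices are isolated and [l] edges lost in total. Each isolation without loss is worth
   a factor n and each lost edge costs one; the subtraction j - l is truncated, so the exponent
   never becomes negative. The bound l <= 2 j keeps l <= 2 h <= m, so m - l is a true difference. *)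
suff main i j l : (j + i = h)%N -> (l <= 2 * j)%N ->
    (#|states R H T j (m - l)| * t <= 90 ^ i * K * n ^ (j - l) * a m)%N.
  by have := main h 0%N 0%N; rewrite !subn0 muln1; apply.
elim: i j l => [|i IH] j l jh lj.
  rewrite addn0 in jh; subst j; rewrite mul1n.
  have q1 := states_plant R T (m - l) Ht; rewrite -/h -/e -/(a _) in q1.
  apply: (@leq_trans (a (m - l + e) * ((2 * h + 1) * h ^ h) * t)).
    by rewrite leq_mul2r q1 orbT.
  have npow d : (0 < n ^ d)%N by rewrite expn_gt0 n0.
  have Dpow d : (0 < D ^ d)%N by rewrite expn_gt0 D0.
  (* If more edges were lost than [H] brings in, the result has fewer than m edges and the gain is
     [t]. Otherwise the surplus costs (D n)^(e - l), and since e < h there remains a factor n >=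
     t. *)
  case: (ltnP e l) => el.
    have hh : (a (m - l + e) * t <= a m)%N.
      have -> : (m - l + e = m - (l - e.+1).+1)%N.
        by move: el lj mh; clear; lia.
      by apply: up1; move: el lj mh eh; clear; lia.
    apply: (@leq_trans (((2 * h + 1) * h ^ h) * a m)).
      by rewrite mulnAC mulnC leq_mul2l hh orbT.
    rewrite leq_mul2r; apply/orP; right.
    by rewrite /K -mulnA leq_pmulr // muln_gt0 Dpow npow.
  have hh : (a (m - l + e) <= a m * (D * n) ^ (e - l))%N.
    have -> : (m - l + e = m + (e - l))%N by move: el lj mh; clear; lia.
    exact: down1.
  apply: (@leq_trans ((a m * (D * n) ^ (e - l)) * ((2 * h + 1) * h ^ h) * n)).
    by rewrite leq_mul // leq_mul2r hh orbT.
  have Dle : (D ^ (e - l) <= D ^ h)%N.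
    by apply: leq_pexp2l => //; move: eh; clear; lia.
  have nle : (n ^ (e - l) * n <= n ^ (h - l))%N.
    by rewrite -expnSr; apply: leq_pexp2l => //; move: eh el; clear; lia.
  have := leq_mul Dle nle; rewrite /K expnMn.
  move: (a m) (D ^ (e - l))%N (n ^ (e - l))%N (D ^ h)%N (n ^ (h - l))%N ((2 * h + 1) * h ^ h)%N.
  move=> A x y x' y' c hxy.
  have -> : (A * (x * y) * c * n = (x * (y * n)) * (c * A))%N by lia.
  have -> : (c * x' * y' * A = (x' * y') * (c * A))%N by lia.
  by rewrite leq_mul2r hxy orbT.
(* From m <= 9 n / 8, [low_degree] yields at least n / 4 vertices of degree at most 2; setting aside
   j <= h <= n / 20 of them leaves n / 5. *)
pose d := (n %/ 5)%N.
have d10 : (n <= 10 * d)%N by rewrite /d; move: nbig; clear; lia.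
have low E : E \in planar_sets R T (m - l) -> (d + j <= #|[set v | (#|nbrs E v| <= 2)%N]%SET|)%N.
  move=> /planar_setsP[Ek pE]; have := low_degree pE; rewrite Ek -/n.
  move: #|_| => w; rewrite /d; move: nbig mn jh; clear; lia.
have st := states_step H low.
have q0 := IH j.+1 l; have q1 := IH j.+1 l.+1; have q2 := IH j.+1 l.+2.
have jh' : (j.+1 + i = h)%N by rewrite addSnnS.
have {}q0 := q0 jh' (leq_trans lj (leq_mul (leqnn 2) (leqnSn j))).
have {}q1 : _ := q1 jh' _; have {}q1 := q1 ltac:(by move: lj; clear; lia).
have {}q2 : _ := q2 jh' _; have {}q2 := q2 ltac:(by move: lj; clear; lia).
rewrite -!subnDA !addn1 !addn2 -/n in st.
have nk : (n + 2 * (m - l) <= 4 * n)%N by move: mn; clear; lia.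
move: st q0 q1 q2; rewrite !subSS.
set s0 := #|states R H T j.+1 _|; set s1 := #|states R H T j.+1 _|.
set s2 := #|states R H T j.+1 _|; set s := #|states R H T j _|.
move=> st q0 q1 q2.
have p0 : (n ^ (j.+1 - l) <= n * n ^ (j - l))%N.
  by rewrite -expnS; apply: leq_pexp2l => //; clear; lia.
have p2 : (n ^ (j - l.+1) <= n ^ (j - l))%N.
  by apply: leq_pexp2l => //; clear; lia.
pose X := (90 ^ i * K * n ^ (j - l) * a m)%N.
have X0 : (s0 * t <= n * X)%N.
  apply: leq_trans q0 _; rewrite /X mulnA leq_mul2r mulnCA leq_mul2l p0.
  by rewrite ?orbT.
have X2 : (s2 * t <= X)%N.
  by apply: leq_trans q2 _; rewrite /X leq_mul2r leq_mul2l p2 !orbT.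
have := recursion_bound n0 d10 nk st X0 q1 X2.
by rewrite /X !mulnA -expnS.
Qed.
End bound.

(** * From edge sets to the probability *)

Section transfer.
Variables (R : realType) (U : finType) (H : sgraph U).
Implicit Types (n m : nat).

Lemma card_planar_graphs n m : #|planar_graphs R n m| = #|planar_sets R 'I_n m|.
Proof.
rewrite -(card_in_imset (f := @edges 'I_n) (D := mem (planar_graphs R n m))); last first.
  by move=> G G' _ _; exact: val_inj.
apply: eq_card => E; apply/imsetP/planar_setsP => [[G]|[Em pE]].
  by rewrite inE => /andP[/eqP Gm /asboolP pG] ->.
have E2 : [forall e in E, #|e| == 2%N].
  by apply/forall_inP => e eE; apply/eqP; exact: planarE_card2 pE eE.
by exists (SGraph E2) => //; rewrite inE /= Em eqxx /=; exact/asboolP.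
Qed.

(** At j = 0 the bound 2 * j on the number of copies says that there is none, so [states] at 0
    accounts for exactly the graphs to be shown rare. *)
Lemma card_no_component n m :
  (#|[set G in planar_graphs R n m | ~~ `[< has_component_iso G H >]]%SET| <=
   #|states R H 'I_n 0 m|)%N.
Proof.
rewrite -(@card_in_imset _ _ (fun G : sgraph 'I_n => ([tuple], edges G) : 0.-tuple 'I_n * _)); last first.
  by move=> G G' _ _ [] /val_inj.
apply/subset_leq_card/fintype.subsetP => x /imsetP[G]; rewrite inE => /andP[].
rewrite inE => /andP[/eqP Gm /asboolP pG] /asboolP nH ->; apply/statesP; split => //.
rewrite leqn0 cards_eq0; apply/eqP/setP => C; rewrite finset.in_set0.
by apply/negP => /has_component_copy.
Qed.

Lemma probability_lower n m (K t : nat) : (0 < t)%N -> (0 < #|planar_sets R 'I_n m|)%N ->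
  (#|states R H 'I_n 0 m| * t <= K * #|planar_sets R 'I_n m|)%N ->
  `|1 - finite_uniform_prob R (planar_graphs R n m) (fun G => has_component_iso G H)|
    <= K%:R / t%:R.
Proof.
move=> t0 a0 hK; rewrite /finite_uniform_prob.
set S := planar_graphs R n m; rewrite -/S -card_planar_graphs -/S in a0 hK.
have := card_no_component n m; rewrite -/S; set B := [set G in S | _]%SET => hB.
set A := [set x in S | _]%SET.
have AB : (#|A| + #|B| = #|S|)%N.
  rewrite -(cardsID [set G | `[< has_component_iso G H >]]%SET S).
  congr (_ + _)%N; apply: eq_card => G.
    by rewrite finset.in_setI !finset.in_set.
  by rewrite finset.in_setD !finset.in_set andbC.
have S0 : (0 : R) < #|S|%:R by rewrite ltr0n.
have -> : 1 - #|A|%:R / #|S|%:R = #|B|%:R / #|S|%:R :> R.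
  by rewrite -AB natrD; field; rewrite -natrD AB gt_eqF.
rewrite ger0_norm ?divr_ge0 // ler_pdivrMr // mulrAC ler_pdivlMr ?ltr0n //.
rewrite -!natrM ler_nat; apply: leq_trans hK.
by rewrite leq_mul2r hB orbT.
Qed.

(** On an empty set [finite_uniform_prob] is 0 by convention, so nonemptiness is needed; the growth
    in k propagates it from the empty edge set. *)
Lemma planar_sets_pos n m (t : nat) : (0 < t)%N ->
  (forall k, (k < m)%N -> (#|planar_sets R 'I_n k| * t <= #|planar_sets R 'I_n k.+1|)%N) ->
  (0 < #|planar_sets R 'I_n m|)%N.
Proof.
move=> t0; elim: m => [_|m IH up].
  apply/card_gt0P; exists finset.set0; apply/planar_setsP.
  by split; [rewrite cards0|exact: planarE0].
apply: leq_trans (up m _) => //; rewrite muln_gt0 t0 andbT.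
by apply: IH => k km; apply: up; exact: ltnW.
Qed.

Lemma probability_bound n m (t D : nat) : is_tree H -> (0 < t)%N -> (0 < D)%N ->
  let s := (2 * (2 * t) + 5)%N in
  (12 * s * (12 * s ^ 2 + 1) + t + (20 * #|U| + 8) + 2 * #|U| * D <= n)%N ->
  (10 * s * m <= (10 * s + 1) * n)%N -> (n <= D * m)%N ->
  `|1 - finite_uniform_prob R (planar_graphs R n m) (fun G => has_component_iso G H)|
    <= (90 ^ #|U| * ((2 * #|U| + 1) * #|U| ^ #|U| * D ^ #|U|))%:R / t%:R.
Proof.
move=> Ht t0 D0 s nbig ms nD.
have [s5 n1] : (5 <= s)%N /\ (12 * s * (12 * s ^ 2 + 1) <= n)%N.
  by split; [rewrite /s; lia|move: nbig; lia].
have sE : s = (2 * (2 * t) + 5)%N by [].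
have [tn [nh nU]] : (t <= n /\ (20 * #|U| + 8 <= n /\ 2 * #|U| * D <= n))%N.
  by move: nbig; move: (12 * s * _)%N (2 * #|U| * D)%N => x y; lia.
clearbody s; have n0 : (0 < n)%N := leq_trans t0 tn.
have m9 : (8 * m <= 9 * n)%N by move: ms s5; clear; nia.
have m2 : (m <= 2 * n)%N by move: m9; clear; lia.
(* [addable_lower] is applied with 2 t: double counting divides the 2 t n addable edges by k + 1 <=
   m <= 2 n, which leaves t. *)
have up k : (k < m)%N -> (#|planar_sets R 'I_n k| * t <= #|planar_sets R 'I_n k.+1|)%N.
  move=> km; have hadd E : E \in planar_sets R 'I_n k -> (2 * t * n <= #|addable R E|)%N.
    move=> /planar_setsP[Ek pE]; have := @addable_lower R _ E (2 * t) pE.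
    by rewrite -sE card_ord Ek; apply => //; apply: leq_trans ms; rewrite leq_mul2l (ltnW km) orbT.
  have := planar_sets_up hadd; move: #|planar_sets R 'I_n k| #|planar_sets R 'I_n k.+1| => x y hxy.
  have n20 : (0 < 2 * n)%N by rewrite muln_gt0.
  rewrite -(leq_pmul2r n20); apply: (@leq_trans (y * k.+1)).
    by have -> : (x * t * (2 * n) = x * (2 * t * n))%N by clear; lia.
  by rewrite leq_mul2l (leq_trans km m2) orbT.
(* For k >= m, n <= D m bounds n^2 / (k + 1) by D n. *)
have down k : (m <= k)%N ->
    (#|planar_sets R 'I_n k.+1| <= #|planar_sets R 'I_n k| * (D * n))%N.
  move=> mk; have := planar_sets_down R 'I_n k; rewrite card_ord.
  move: #|planar_sets R 'I_n k| #|planar_sets R 'I_n k.+1| => y x hxy; rewrite -(leq_pmul2r n0).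
  apply: (@leq_trans (x * k.+1 * D)).
    rewrite -mulnA leq_mul2l mulnC; apply/orP; right.
    by apply: leq_trans nD _; rewrite leq_mul2l (leq_trans mk) ?orbT.
  by apply: (@leq_trans (y * (n * n) * D)); [rewrite leq_mul2r hxy orbT|lia].
have m2U : (2 * #|U| <= m)%N.
  by rewrite -(leq_pmul2r D0); apply: leq_trans nU _; rewrite mulnC.
apply: probability_lower => //; first exact: planar_sets_pos up.
apply: states_bound; rewrite ?card_ord ?t0 //.
Qed.

End transfer.

Unset Implicit Arguments.

Theorem theorem3p3 (R : realType) (U : finType) (H : sgraph U) (c : R)
    (m : nat -> nat) (eps : nat -> R) :
  is_tree H ->
  0 < c ->
  eps @ \oo --> (0 : R) ->
  (\forall n \near \oo, c * n%:R <= (m n)%:R <= (1 + eps n) * n%:R) ->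
  (fun n => finite_uniform_prob R (planar_graphs R n (m n))
              (fun G => has_component_iso G H)) @ \oo --> (1 : R).
Proof.
move=> Ht c0 eps0 hm; apply/cvgrPdist_le => r r0.
(* An integer above 1 / c, so that c n <= m gives n <= D m. *)
pose D := Num.bound c^-1.
have hD : c^-1 < D%:R by apply: archi_boundP; rewrite invr_ge0 ltW.
have D0 : (0 < D)%N by rewrite -(ltr0n R); apply: lt_trans hD; rewrite invr_gt0.
pose K : R := (90 ^ #|U| * ((2 * #|U| + 1) * #|U| ^ #|U| * D ^ #|U|))%:R.
(* [K] is fixed before [t], so [t] can be taken large enough for K / t <= r. *)
pose t := (Num.bound (K / r)).+1.
have Kt : K / t%:R <= r.
  rewrite ler_pdivrMr ?ltr0n // mulrC -ler_pdivrMr //; apply: ltW.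
  apply: lt_trans (archi_boundP _) _; first by rewrite divr_ge0 ?ler0n // ltW.
  by rewrite ltr_nat.
pose s := (2 * (2 * t) + 5)%N.
have s0 : (0 : R) < (10 * s)%:R by rewrite ltr0n muln_gt0 /s addn_gt0 orbT.
(* The relative excess of m over n that [probability_bound] tolerates for this [t]; eventually |eps
   n| is at most this. *)
have d0 : 0 < ((10 * s)%:R^-1 : R) by rewrite invr_gt0.
have /cvgrPdist_le/(_ _ d0) heps := eps0.
near=> n.
have /andP[cm mn] : c * n%:R <= (m n)%:R <= (1 + eps n) * n%:R by near: n.
have en : `|0 - eps n| <= (10 * s)%:R^-1 by near: n.
have nbig : (12 * s * (12 * s ^ 2 + 1) + t + (20 * #|U| + 8) + 2 * #|U| * D <= n)%N.
  by near: n; exact: nbhs_infty_ge.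
apply: le_trans Kt; apply: probability_bound => //.
- rewrite -/s; move: s0 en; move: (10 * s)%N => q q0 en.
  rewrite -(ler_nat R) [(q * m n)%:R]natrM [((q + 1) * n)%:R]natrM natrD.
  apply: le_trans (_ : q%:R * ((1 + eps n) * n%:R) <= _); first by rewrite ler_pM2l.
  rewrite mulrA ler_wpM2r ?ler0n // mulrDr mulr1 lerD2l.
  rewrite mulrC -ler_pdivlMr // mul1r; apply: le_trans en.
  by rewrite sub0r normrN ler_norm.
- rewrite -(ler_nat R) natrM.
  have h : n%:R <= c^-1 * (m n)%:R by rewrite mulrC ler_pdivlMr // mulrC.
  by apply: le_trans h _; rewrite ler_wpM2r ?ler0n // ltW.
Unshelve. all: by end_near.
Qed.
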